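(* Consider the following real Lie superalgebras of superdimension $2|2$ with homogeneous basis $e_1,e_2\,|\,e_3,e_4$ ($e_1,e_2$ even, $e_3,e_4$ odd; brackets not determined by the displayed ones through super anti-commutativity are zero; parameters are real). - $D^5$: $[e_1,e_3]=e_3$, $[e_1,e_4]=e_4$, $[e_2,e_4]=e_3$. - $D^6$: $[e_1,e_3]=e_3$, $[e_1,e_4]=e_4$, $[e_2,e_3]=-e_4$, $[e_2,e_4]=e_3$. - $D^7_{pq}$ ($pq\ne0$): $[e_1,e_2]=e_2$, $[e_1,e_3]=pe_3$, $[e_1,e_4]=qe_4$. - $D^8_{-1}$: $[e_1,e_2]=e_2$, $[e_1,e_3]=-e_3$, $[e_1,e_4]=e_3-e_4$. - $D^{10}_q$: $[e_1,e_2]=e_2$, $[e_1,e_3]=(q+1)e_3$, $[e_1,e_4]=qe_4$, $[e_2,e_4]=e_3$. - $(D^7_{1/2\,1/2})^1$: $[e_1,e_2]=e_2$, $[e_1,e_3]=\frac12e_3$, $[e_1,e_4]=\frac12e_4$, $[e_3,e_3]=e_2$, $[e_4,e_4]=e_2$. - $(D^7_{1/2\,1/2})^2$: $[e_1,e_2]=e_2$, $[e_1,e_3]=\frac12e_3$, $[e_1,e_4]=\frac12e_4$, $[e_3,e_3]=e_2$, $[e_4,e_4]=-e_2$. - $(D^7_{1-p,p})$: $[e_1,e_2]=e_2$, $[e_1,e_3]=pe_3$, $[e_1,e_4]=(1-p)e_4$, $[e_3,e_4]=e_2$. - $(D^9_{1/2,p})$: $[e_1,e_2]=e_2$, $[e_1,e_3]=\frac12e_3-pe_4$,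 $[e_1,e_4]=pe_3+\frac12e_4$, $[e_3,e_3]=e_2$, $[e_4,e_4]=e_2$. - $(D^{10}_0)^1$: $[e_1,e_2]=e_2$, $[e_1,e_3]=e_3$, $[e_2,e_4]=e_3$, $[e_4,e_4]=e_1$, $[e_3,e_4]=-\frac12e_2$. - $(D^{10}_0)^2$: $[e_1,e_2]=e_2$, $[e_1,e_3]=e_3$, $[e_2,e_4]=e_3$, $[e_4,e_4]=-e_1$, $[e_3,e_4]=\frac12e_2$. - $(2A_{1,1}+2A)^3_p$: $[e_3,e_3]=e_1$, $[e_4,e_4]=e_2$, $[e_3,e_4]=p(e_1+e_2)$. - $(C^1_1+A)$: $[e_1,e_2]=e_2$, $[e_1,e_3]=e_3$, $[e_3,e_4]=e_2$. - $(C^1_{1/2}+A)$: $[e_1,e_2]=e_2$, $[e_1,e_3]=\frac12e_3$, $[e_3,e_3]=e_2$. - $(C^3+A)$: $[e_1,e_4]=e_3$, $[e_4,e_4]=e_2$. Then: (i) Each of the following is isomorphic to a $T^*$-extension of a two-dimensional Lie superalgebra: $D^7_{pq}$ with $p=-q$, $q\neq0$; $(D^7_{1/2\,1/2})^2$; $(D^7_{1-p,p})$ with $p\le\frac12$; $(D^{10}_0)^1$; $(D^{10}_0)^2$; $(C^1_1+A)$; $(C^3+A)$. (ii) Each of the following is isomorphic to a $\Pi T^*$-extension of a two-dimensional Lie superalgebra: $D^5$; $D^6$; $D^7_{-1,q}$ with $q\le1$, $q\neq0$; $D^7_{pq}$ with $(p,q)=(1,-1)$; $D^8_{-1}$; $D^{10}_q$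 with $q\ne-1$; $(D^{10}_0)^1$; $(D^{10}_0)^2$; $(2A_{1,1}+2A)^3_p$ with $p=\frac12$. (iii) Each of the following is quasi-Frobenius with a homogeneous (orthosymplectic) form but is neither isomorphic to a $T^*$-extension nor to a $\Pi T^*$-extension of a Lie superalgebra: $(D^7_{1/2\,1/2})^1$; $(D^9_{1/2,p})$ with $p>0$; $(C^1_{1/2}+A)$.
   Context: The ground field is $\mathbb R$; $|x|$ is the parity of a homogeneous element. Lie superalgebras satisfy $[x,y]=-(-1)^{|x||y|}[y,x]$ and $[x,[y,z]]=[[x,y],z]+(-1)^{|x||y|}[y,[x,z]]$. $\Pi$ denotes the change-of-parity functor: $\Pi(V)_{\bar0}=V_{\bar1}$, $\Pi(V)_{\bar1}=V_{\bar0}$, with the canonical odd map $\Pi:V\to\Pi(V)$, and $\Pi(\Pi(V))$ is identified with $V$. A bilinear form $\omega$ is anti-symmetric if $\omega(x,y)=-(-1)^{|x||y|}\omega(y,x)$ for homogeneous $x,y$. On a Lie superalgebra it is closed if $(-1)^{|x||z|}\omega(x,[y,z])+(-1)^{|z||y|}\omega(z,[x,y])+(-1)^{|y||x|}\omega(y,[z,x])=0$ for homogeneous $x,y,z$. A Lie superalgebra is quasi-Frobenius if it has a closed non-degenerate anti-symmetric bilinear form; the form is orthosymplectic if it is even and periplectic if it is odd. A connection on a Lie superalgebra $\mathfrak h$ is an even bilinear map $\nabla:\mathfrak h\times\mathfrak h\to\mathfrak h$, $(x,y)\mapsto\nabla_xy$. It is torsion-free if $\nabla_xy-(-1)^{|x||y|}\nabla_yx=[x,y]$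 and flat if $\nabla_x\nabla_y z-(-1)^{|x||y|}\nabla_y\nabla_x z=\nabla_{[x,y]}z$ for all homogeneous $x,y,z$. Given a torsion-free flat connection, define representations of $\mathfrak h$ on $\mathfrak h^*$ and on $\Pi(\mathfrak h^* )$ by $\rho(u)\cdot\xi=-(-1)^{|u||\xi|}\xi\circ\nabla_u$ and $\chi(u)=(-1)^{|u|}\,\Pi\circ\rho(u)\circ\Pi$. $T^*$-extension of $(\mathfrak h,\nabla)$ (with $\nabla$ torsion-free and flat) by an even 2-cocycle $\alpha\in Z^2(\mathfrak h,\mathfrak h^* )$ (with respect to $\rho$) satisfying $(-1)^{|u||w|}\alpha(u,v)(w)+\text{(cyclic permutations of }u,v,w)=0$ for homogeneous $u,v,w$: the Lie superalgebra $\mathfrak h\oplus\mathfrak h^*$ with $[u,v]=[u,v]_{\mathfrak h}+\alpha(u,v)$, $[u,\xi]=\rho(u)\cdot\xi$, $[\mathfrak h^*,\mathfrak h^*]=0$. It carries the even closed non-degenerate anti-symmetric form $\omega(u+\xi,v+\zeta)=\xi(v)-(-1)^{|\zeta||u|}\zeta(u)$. $\Pi T^*$-extension of $(\mathfrak h,\nabla)$ by an even 2-cocycle $\beta\in Z^2(\mathfrak h,\Pi(\mathfrak h^* ))$ (with respect to $\chi$) satisfying $(-1)^{|u||w|}\,\Pi(\beta(u,v))(w)+\text{(cyclic permutations of }u,v,w)=0$: the Lie superalgebra $\mathfrak h\oplus\Pi(\mathfrak h^* )$ with $[u,v]=[u,v]_{\mathfrak h}+\beta(u,v)$, $[u,\Pi(\xi)]=\chi(u)\cdot\Pi(\xi)$,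 $[\Pi(\mathfrak h^* ),\Pi(\mathfrak h^* )]=0$. It carries the odd closed non-degenerate anti-symmetric form $\kappa(u+\Pi(\xi),v+\Pi(\zeta))=\xi(v)-(-1)^{(|\zeta|+1)|u|}\zeta(u)$. Lagrangian extensions are the $T^*$- and $\Pi T^*$-extensions. The isomorphisms in the claim are isomorphisms of Lie superalgebras. *)

(* Defs.v *)
From HB Require Import structures.
From mathcomp Require Import all_boot all_order all_algebra.
From mathcomp Require Import reals.
From mathcomp Require Import ring lra.

Set Implicit Arguments.
Unset Strict Implicit.
Unset Printing Implicit Defensive.

Import Order.TTheory GRing.Theory Num.Theory.
Local Open Scope ring_scope.

Section Superspaces.
Variable R : realType.

(* A finite-dimensional Z/2-graded space, the decomposition V = V_0 (+) V_1
   being given by its two projections: [pr b x] is the component of parity [b]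
   of [x] (parities are booleans, [false] is even, [(+)] is their sum). *)
Record superspace := Superspace {
  sp_vect :> vectType R;
  pr : bool -> {linear sp_vect -> sp_vect};
  pr_pr : forall a b x, pr a (pr b x) = if a == b then pr b x else 0;
  pr_sum : forall x, pr false x + pr true x = x }.

(* [0] is homogeneous of both parities. *)
Definition homog (V : superspace) (b : bool) (x : V) : Prop := pr V b x = x.

Section Dual.
Variable V : superspace.

Definition dual_pr (b : bool) (xi : 'Hom(V, R^o)) : 'Hom(V, R^o) :=
  (xi \o linfun (pr V b))%VF.

Fact dual_pr_linear b : linear (dual_pr b).
Proof.
by move=> a x y; rewrite /dual_pr comp_lfunDl -comp_lfunZl.
Qed.
HB.instance Definition _ b :=
  GRing.isLinear.Build R 'Hom(V, R^o) 'Hom(V, R^o) *:%R (dual_pr b)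
    (dual_pr_linear b).

Fact dual_pr_pr a b x :
  dual_pr a (dual_pr b x) = if a == b then dual_pr b x else 0.
Proof.
apply/lfunP => v; rewrite !comp_lfunE !lfunE /= pr_pr eq_sym.
case: eqP => [->|_]; first by rewrite !comp_lfunE !lfunE.
by rewrite linear0 zero_lfunE.
Qed.

Fact dual_pr_sum x : dual_pr false x + dual_pr true x = x.
Proof.
by apply/lfunP => v; rewrite add_lfunE !comp_lfunE !lfunE -linearD /= pr_sum.
Qed.

(* A linear form is homogeneous of parity b iff it vanishes on the part of
   parity b + 1. *)
Definition dual : superspace :=
  @Superspace 'Hom(V, R^o) (fun b => dual_pr b) dual_pr_pr dual_pr_sum.

Definition ev (xi : dual) (x : V) : R := (xi : 'Hom(V, R^o)) x.

End Dual.

Section Parity.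
Variable V : superspace.

Fact parity_pr_pr a b (x : V) :
  pr V (~~ a) (pr V (~~ b) x) = if a == b then pr V (~~ b) x else 0.
Proof. by rewrite pr_pr; case: a; case: b. Qed.

Fact parity_pr_sum (x : V) : pr V (~~ false) x + pr V (~~ true) x = x.
Proof. by rewrite addrC pr_sum. Qed.

Definition Pi : superspace :=
  @Superspace V (fun b => pr V (~~ b)) parity_pr_pr parity_pr_sum.

(* The canonical odd map V -> Pi V and its inverse, which is also the
   canonical odd map Pi V -> Pi (Pi V) = V. *)
Definition toPi (x : V) : Pi := x.
Definition ofPi (x : Pi) : V := x.

End Parity.

Section DirectSum.
Variables V W : superspace.

Definition sum_pr (b : bool) (x : V * W) : V * W := (pr V b x.1, pr W b x.2).

Fact sum_pr_linear b : linear (sum_pr b).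
Proof. by move=> a x y; rewrite /sum_pr !linearP. Qed.
HB.instance Definition _ b :=
  GRing.isLinear.Build R (V * W)%type (V * W)%type *:%R (sum_pr b)
    (sum_pr_linear b).

Fact sum_pr_pr a b x : sum_pr a (sum_pr b x) = if a == b then sum_pr b x else 0.
Proof. by rewrite /sum_pr /= !pr_pr; case: eqP. Qed.

Fact sum_pr_sum x : sum_pr false x + sum_pr true x = x.
Proof. by case: x => x y; congr pair; rewrite /= pr_sum. Qed.

Definition dsum : superspace :=
  @Superspace (V * W)%type (fun b => sum_pr b) sum_pr_pr sum_pr_sum.

End DirectSum.

End Superspaces.

Section LieSuperalgebras.
Variable R : realType.

Record lieSuperalg := LieSuperalg {
  ls_space :> superspace R;
  br : ls_space -> ls_space -> ls_space;
  br_linear_l : forall y, linear (fun x => br x y);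
  br_linear_r : forall x, linear (br x);
  br_even : forall a b x y, homog a x -> homog b y -> homog (a (+) b) (br x y);
  br_anti : forall a b x y, homog a x -> homog b y ->
    br x y = - ((-1) ^+ (a && b) *: br y x);
  br_jacobi : forall a b c x y z, homog a x -> homog b y -> homog c z ->
    br x (br y z) = br (br x y) z + (-1) ^+ (a && b) *: br y (br x z) }.

Definition isomorphic (g h : lieSuperalg) : Prop :=
  exists f : 'Hom(g, h),
    [/\ bijective f,
        forall b x, homog b x -> homog b (f x)
      & forall x y, f (br x y) = br (f x) (f y)].

Record rep (h : lieSuperalg) (M : superspace R) := Rep {
  act :> h -> M -> M;
  act_linear_l : forall m, linear (fun u => act u m);
  act_linear_r : forall u, linear (act u);
  act_even : forall a b u m, homog a u -> homog b m -> homog (a (+) b) (act u m);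
  act_br : forall a b c u v m, homog a u -> homog b v -> homog c m ->
    act (br u v) m = act u (act v m) - (-1) ^+ (a && b) *: act v (act u m) }.

Record cocycle2 (h : lieSuperalg) (M : superspace R) (r : rep h M) := Cocycle2 {
  cval :> 'Hom(h, 'Hom(h, M));
  cval_even : forall a b u v, homog a u -> homog b v ->
    homog (a (+) b) (cval u v);
  cval_anti : forall a b u v, homog a u -> homog b v ->
    cval u v = - ((-1) ^+ (a && b) *: cval v u);
  cval_closed : forall a b c u v w, homog a u -> homog b v -> homog c w ->
    r u (cval v w) - (-1) ^+ (a && b) *: r v (cval u w)
      + (-1) ^+ ((a (+) b) && c) *: r w (cval u v)
      - cval (br u v) w + (-1) ^+ (b && c) *: cval (br u w) v
      + cval u (br v w) = 0 }.

Lemma homogD (V : superspace R) b (x y : V) :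
  homog b x -> homog b y -> homog b (x + y).
Proof. by rewrite /homog linearD => -> ->. Qed.

Lemma homogN (V : superspace R) b (x : V) : homog b x -> homog b (- x).
Proof. by rewrite /homog linearN => ->. Qed.

Lemma homogZ (V : superspace R) b k (x : V) : homog b x -> homog b (k *: x).
Proof. by rewrite /homog linearZ /= => ->. Qed.

Lemma homog_pr (V : superspace R) b (x : V) : homog b (pr V b x).
Proof. by rewrite /homog pr_pr eqxx. Qed.

Lemma homog_prE (V : superspace R) a b (x : V) :
  homog b x -> pr V a x = if a == b then x else 0.
Proof. by move=> hx; rewrite -{1}hx pr_pr hx. Qed.

Lemma additive_eq (V : vectType R) (x y : V) :
  (forall f : V -> R, f 0 = 0 -> (forall u v, f (u + v) = f u + f v) ->
     (forall u, f (- u) = - f u) -> f x = f y) -> x = y.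
Proof.
move=> e; rewrite (coord_vbasis (memvf x)) (coord_vbasis (memvf y)).
apply: eq_bigr => i _; congr (_ *: _).
by apply: e => [|u v|u]; [exact: linear0|exact: linearD|exact: linearN].
Qed.

Section AbelianExtension.
Variables (h : lieSuperalg) (M : superspace R) (r : rep h M) (c : cocycle2 r).

(* [m, v] = -(-1)^(|v||m|) [v, m] for m in M and v in h, extended to
   non-homogeneous arguments. *)
Definition ract (m : M) (v : h) : M :=
  - \sum_(a : bool) \sum_(b : bool) (-1) ^+ (a && b) *: r (pr h a v) (pr M b m).

(* [u + m, v + n] = [u, v] + c(u, v) + [u, n] + [m, v] *)
Definition ext_br (x y : dsum h M) : dsum h M :=
  (br x.1 y.1, c x.1 y.1 + r x.1 y.2 + ract x.2 y.1).

Let rD u m n : r u (m + n) = r u m + r u n.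
Proof. by have := act_linear_r r u 1 m n; rewrite !scale1r. Qed.
Let rDl u v m : r (u + v) m = r u m + r v m.
Proof. by have := act_linear_l r m 1 u v; rewrite !scale1r. Qed.
Let r0 u : r u 0 = 0.
Proof. by apply: (@addrI _ (r u 0)); rewrite -rD !addr0. Qed.
Let r0l m : r 0 m = 0.
Proof. by apply: (@addrI _ (r 0 m)); rewrite -rDl !addr0. Qed.
Let rZ u k m : r u (k *: m) = k *: r u m.
Proof. by have := act_linear_r r u k m 0; rewrite !addr0 r0 addr0. Qed.
Let rZl u k m : r (k *: u) m = k *: r u m.
Proof. by have := act_linear_l r m k u 0; rewrite !addr0 r0l addr0. Qed.
Let rN u m : r u (- m) = - r u m.
Proof. by rewrite -scaleN1r rZ scaleN1r. Qed.

Let ractE a b m v : homog b m -> homog a v ->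
  ract m v = - ((-1) ^+ (a && b) *: r v m).
Proof.
move=> hm hv; rewrite /ract !big_bool !(homog_prE _ hm) !(homog_prE _ hv).
by case: a hv => hv; case: b hm => hm /=;
  rewrite ?r0 ?r0l ?scaler0 ?addr0 ?add0r.
Qed.

Let ract_linear_l v : linear (fun m => ract m v).
Proof.
move=> k m n; rewrite /ract scalerN -opprD scaler_sumr -big_split /=.
congr (- _); apply: eq_bigr => a _; rewrite scaler_sumr -big_split /=.
by apply: eq_bigr => b _; rewrite linearP rD rZ scalerDr !scalerA mulrC.
Qed.

Let ract_linear_r m : linear (ract m).
Proof.
move=> k u v; rewrite /ract scalerN -opprD scaler_sumr -big_split /=.
congr (- _); apply: eq_bigr => a _; rewrite scaler_sumr -big_split /=.
by apply: eq_bigr => b _; rewrite linearP rDl rZl scalerDr !scalerA mulrC.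
Qed.

Fact ext_br_linear_l y : linear (fun x => ext_br x y).
Proof.
move=> k x1 x2; rewrite /ext_br /=; congr pair => /=; first exact: br_linear_l.
rewrite linearP add_lfunE scale_lfunE (act_linear_l r y.2 k) ract_linear_l.
by rewrite !scalerDr [X in X + _ = _]addrACA [LHS]addrACA.
Qed.

Fact ext_br_linear_r x : linear (ext_br x).
Proof.
move=> k y1 y2; rewrite /ext_br /=; congr pair => /=; first exact: br_linear_r.
rewrite linearP (act_linear_r r x.1 k) ract_linear_r.
by rewrite !scalerDr [X in X + _ = _]addrACA [LHS]addrACA.
Qed.

Let homog_sum b (x : dsum h M) : homog b x -> homog b x.1 /\ homog b x.2.
Proof. by case: x => x m [hx hm]. Qed.

Fact ext_br_even a b x y : homog a x -> homog b y ->
  homog (a (+) b) (ext_br x y).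
Proof.
move=> /homog_sum[x1 x2] /homog_sum[y1 y2]; congr pair => /=.
  exact: br_even.
apply: homogD; first by apply: homogD; [exact: cval_even|exact: act_even].
rewrite (ractE x2 y1); apply/homogN/homogZ; rewrite addbC.
exact: act_even.
Qed.

Fact ext_br_anti a b x y : homog a x -> homog b y ->
  ext_br x y = - ((-1) ^+ (a && b) *: ext_br y x).
Proof.
move=> /homog_sum[x1 x2] /homog_sum[y1 y2]; rewrite /ext_br; congr pair => /=.
  exact: br_anti.
rewrite (ractE x2 y1) (ractE y2 x1) (cval_anti c x1 y1).
rewrite (andbC b a) !scalerDr scalerN scalerA -signr_addb addbb scale1r.
by rewrite !opprD opprK -addrA -addrA [X in _ + X]addrC.
Qed.

Fact ext_br_jacobi a b d x y z : homog a x -> homog b y -> homog d z ->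
  ext_br x (ext_br y z) =
    ext_br (ext_br x y) z + (-1) ^+ (a && b) *: ext_br y (ext_br x z).
Proof.
move=> /[dup] hx /homog_sum[x1 x2] /[dup] hy /homog_sum[y1 y2].
move=> /[dup] hz /homog_sum[z1 z2].
have [_ hxy2] := homog_sum (ext_br_even hx hy).
have hyz := br_even y1 z1; have hxz := br_even x1 z1.
rewrite {1 3 5}/ext_br; congr pair => /=; first exact: (br_jacobi x1 y1 z1).
rewrite (ractE x2 hyz) (ractE hxy2 z1) (ractE y2 hxz).
rewrite (act_br r x1 y1 z2) (act_br r y1 z1 x2) (act_br r x1 z1 y2).
rewrite /= (ractE y2 z1) (ractE x2 y1) (ractE x2 z1).
rewrite !(rD, rN, rZ).
have := cval_closed c x1 y1 z1.
have := cval_anti c y1 hxz.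
case: a {hx x1 x2 hxz hxy2 hyz}; case: b {hy y1 y2}; case: d {hz z1 z2};
  rewrite /= ?expr0 ?expr1 ?scale1r ?scaleN1r ?opprK => e1 e2;
  apply: additive_eq => f f0 fD fN; move: (congr1 f e1) (congr1 f e2);
  rewrite !(f0, fD, fN) => {}e1 {}e2; lra.
Qed.

Definition abelian_ext : lieSuperalg :=
  LieSuperalg ext_br_linear_l ext_br_linear_r ext_br_even ext_br_anti
    ext_br_jacobi.

End AbelianExtension.

Record flat_connection (h : lieSuperalg) := FlatConnection {
  nabla :> 'Hom(h, 'End(h));
  nabla_even : forall a b x y, homog a x -> homog b y ->
    homog (a (+) b) (nabla x y);
  nabla_torsion_free : forall a b x y, homog a x -> homog b y ->
    nabla x y - (-1) ^+ (a && b) *: nabla y x = br x y;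
  nabla_flat : forall a b c x y z, homog a x -> homog b y -> homog c z ->
    nabla x (nabla y z) - (-1) ^+ (a && b) *: nabla y (nabla x z) =
      nabla (br x y) z }.

Lemma linear_zero (U V : lmodType R) (f : U -> V) : linear f -> f 0 = 0.
Proof.
move=> lf; apply: (@addIr _ (f 0)); rewrite add0r.
by have := lf 1 0 0; rewrite !scale1r addr0 => <-.
Qed.

Lemma linear_scale (U V : lmodType R) (f : U -> V) k x :
  linear f -> f (k *: x) = k *: f x.
Proof. by move=> lf; rewrite -[k *: x]addr0 lf (linear_zero lf) addr0. Qed.

Section LagrangianExtensions.
Variables (h : lieSuperalg) (D : flat_connection h).

(* rho(u).xi = -(-1)^(|u||xi|) xi o nabla_u, extended to non-homogeneous
   arguments. *)
Definition rho_act (u : h) (xi : dual h) : dual h :=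
  - \sum_(a : bool) \sum_(b : bool)
      (-1) ^+ (a && b) *:
        ((pr (dual h) b xi : 'Hom(h, R^o)) \o D (pr h a u))%VF.

Lemma nabla_flatE a b u v : homog a u -> homog b v ->
  D (br u v) = (D u \o D v - (-1) ^+ (a && b) *: (D v \o D u))%VF.
Proof.
move=> hu hv; apply/lfunP => z; rewrite -(pr_sum z) !linearD /=.
congr (_ + _); rewrite !lfun_simp /=; apply/esym;
  exact: (nabla_flat D hu hv (homog_pr _ _)).
Qed.

Lemma rho_actE a b u xi : homog a u -> homog b xi ->
  rho_act u xi = - ((-1) ^+ (a && b) *: ((xi : 'Hom(h, R^o)) \o D u)%VF).
Proof.
move=> hu hx; rewrite /rho_act !big_bool.
rewrite !(homog_prE _ hu) !(homog_prE _ hx).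
case: a hu => hu; case: b hx => hx /=;
  by rewrite ?linear0 ?comp_lfun0l ?comp_lfun0r ?scaler0 ?addr0 ?add0r.
Qed.

Fact rho_linear_l xi : linear (fun u => rho_act u xi).
Proof.
move=> k u v; rewrite /rho_act scalerN -opprD scaler_sumr -big_split /=.
congr (- _); apply: eq_bigr => a _; rewrite scaler_sumr -big_split /=.
apply: eq_bigr => b _; rewrite (linearP (pr h a)) (linearP (nabla D)) comp_lfunDr -comp_lfunZr.
by rewrite scalerDr !scalerA mulrC.
Qed.

Fact rho_linear_r u : linear (rho_act u).
Proof.
move=> k xi zeta; rewrite /rho_act scalerN -opprD scaler_sumr -big_split /=.
congr (- _); apply: eq_bigr => a _; rewrite scaler_sumr -big_split /=.
apply: eq_bigr => b _; rewrite linearP comp_lfunDl -comp_lfunZl.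
by rewrite scalerDr !scalerA mulrC.
Qed.

Lemma homog_dualP b (xi : dual h) :
  homog b xi <-> (forall x, homog (~~ b) x -> ev xi x = 0).
Proof.
rewrite /homog /ev /=; split=> [<- x hx|e].
  by rewrite comp_lfunE lfunE /= (homog_prE _ hx); case: b {hx}; rewrite linear0.
apply/lfunP => x; rewrite comp_lfunE lfunE /= -{2}(pr_sum x) linearD.
by case: b e => e; have /= -> := e _ (homog_pr _ x); rewrite ?add0r ?addr0.
Qed.

Fact rho_even a b u xi : homog a u -> homog b xi ->
  homog (a (+) b) (rho_act u xi).
Proof.
move=> hu hx; rewrite (rho_actE hu hx); apply/homogN/homogZ.
apply/homog_dualP => x hx'; rewrite /ev comp_lfunE.
move/homog_dualP: hx; apply; have := nabla_even D hu hx'.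
by case: a {hu hx'}; case: b.
Qed.

Fact rho_br a b c u v xi : homog a u -> homog b v -> homog c xi ->
  rho_act (br u v) xi =
    rho_act u (rho_act v xi) - (-1) ^+ (a && b) *: rho_act v (rho_act u xi).
Proof.
move=> hu hv hx; rewrite (rho_actE (br_even hu hv) hx).
rewrite (rho_actE hu (rho_even hv hx)) (rho_actE hv (rho_even hu hx)).
rewrite (rho_actE hu hx) (rho_actE hv hx).
rewrite (nabla_flatE hu hv).
by case: a {hu}; case: b {hv}; case: c {hx};
  rewrite /= ?expr0 ?expr1 ?scale1r ?scaleN1r ?opprK;
  apply/lfunP => z; rewrite !lfun_simp /= ?linearD ?linearN /=; ring.
Qed.

Definition rho : rep h (dual h) :=
  Rep rho_linear_l rho_linear_r rho_even rho_br.

(* chi(u) = (-1)^|u| Pi o rho(u) o Pi *)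
Definition chi_act (u : h) (m : Pi (dual h)) : Pi (dual h) :=
  \sum_(a : bool) (-1) ^+ a *: toPi (rho_act (pr h a u) (ofPi m)).

Lemma chi_actE a u m : homog a u ->
  chi_act u m = (-1) ^+ a *: toPi (rho_act u (ofPi m)).
Proof.
move=> hu; rewrite /chi_act big_bool !(homog_prE _ hu).
have r0 := linear_zero (rho_linear_l (ofPi m)).
by case: a hu => hu /=; rewrite /toPi r0 scaler0 ?addr0 ?add0r.
Qed.

Fact chi_linear_l m : linear (fun u => chi_act u m).
Proof.
move=> k u v; rewrite /chi_act scaler_sumr -big_split /=.
apply: eq_bigr => a _; rewrite /toPi (linearP (pr h a)) rho_linear_l.
by rewrite scalerDr !scalerA mulrC.
Qed.

Fact chi_linear_r u : linear (chi_act u).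
Proof.
move=> k m n; rewrite /chi_act scaler_sumr -big_split /=.
apply: eq_bigr => a _; rewrite /toPi /ofPi rho_linear_r.
by rewrite scalerDr !scalerA mulrC.
Qed.

Fact chi_even a b u m : homog a u -> homog b m ->
  homog (a (+) b) (chi_act u m).
Proof.
move=> hu hm; rewrite (chi_actE m hu); apply: homogZ.
have := rho_even hu (hm : homog (~~ b) (ofPi m)).
by rewrite /homog /= addbN.
Qed.

Fact chi_br a b c u v m : homog a u -> homog b v -> homog c m ->
  chi_act (br u v) m =
    chi_act u (chi_act v m) - (-1) ^+ (a && b) *: chi_act v (chi_act u m).
Proof.
move=> hu hv hm.
have rZ w k xi := linear_scale k xi (rho_linear_r w).
rewrite (chi_actE m (br_even hu hv)) (chi_actE (chi_act v m) hu)
  (chi_actE (chi_act u m) hv).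
rewrite (chi_actE m hu) (chi_actE m hv) /toPi /ofPi.
rewrite (rho_br hu hv (hm : homog (~~ c) (ofPi m))) !rZ scalerBr !scalerA.
congr (_ - _ *: _); first by rewrite signr_addb.
by rewrite signr_addb mulrC [X in _ * X]mulrC mulrA.
Qed.

Definition chi : rep h (Pi (dual h)) :=
  Rep chi_linear_l chi_linear_r chi_even chi_br.

Definition Tcyclic (alpha : cocycle2 rho) : Prop :=
  forall a b c u v w, homog a u -> homog b v -> homog c w ->
    (-1) ^+ (a && c) * ev (alpha u v) w
      + (-1) ^+ (b && a) * ev (alpha v w) u
      + (-1) ^+ (c && b) * ev (alpha w u) v = 0.

Definition PiTcyclic (beta : cocycle2 chi) : Prop :=
  forall a b c u v w, homog a u -> homog b v -> homog c w ->
    (-1) ^+ (a && c) * ev (ofPi (beta u v)) w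
      + (-1) ^+ (b && a) * ev (ofPi (beta v w)) u
      + (-1) ^+ (c && b) * ev (ofPi (beta w u)) v = 0.

End LagrangianExtensions.

Definition is_Tstar_extension (g h : lieSuperalg) : Prop :=
  exists (D : flat_connection h) (alpha : cocycle2 (rho D)),
    Tcyclic alpha /\ isomorphic g (abelian_ext alpha).

Definition is_PiTstar_extension (g h : lieSuperalg) : Prop :=
  exists (D : flat_connection h) (beta : cocycle2 (chi D)),
    PiTcyclic beta /\ isomorphic g (abelian_ext beta).

(* Two-dimensional refers to the total dimension: the superdimension of h is
   2|0, 1|1 or 0|2. *)
Definition Tstar_dim2 (g : lieSuperalg) : Prop :=
  exists h : lieSuperalg, \dim {:h} = 2%N /\ is_Tstar_extension g h.

Definition PiTstar_dim2 (g : lieSuperalg) : Prop :=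
  exists h : lieSuperalg, \dim {:h} = 2%N /\ is_PiTstar_extension g h.

Section Forms.
Variables (g : lieSuperalg) (w : 'Hom(g, 'Hom(g, R^o))).

Definition antisymmetric_form : Prop :=
  forall a b x y, homog a x -> homog b y ->
    w x y = - ((-1) ^+ (a && b) * w y x).

Definition closed_form : Prop :=
  forall a b c x y z, homog a x -> homog b y -> homog c z ->
    (-1) ^+ (a && c) * w x (br y z) + (-1) ^+ (c && b) * w z (br x y)
      + (-1) ^+ (b && a) * w y (br z x) = 0.

Definition nondegenerate_form : Prop :=
  forall x, (forall y, w x y = 0) -> x = 0.

Definition even_form : Prop :=
  forall a b x y, homog a x -> homog b y -> a != b -> w x y = 0.

End Forms.

Definition orthosymplectic_quasi_frobenius (g : lieSuperalg) : Prop :=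
  exists w : 'Hom(g, 'Hom(g, R^o)),
    [/\ antisymmetric_form w, closed_form w, nondegenerate_form w
      & even_form w].

End LieSuperalgebras.

Section Tables.
Variable R : realType.

Definition r22_pr (b : bool) (x : 'rV[R]_4) : 'rV[R]_4 :=
  \row_j (if (1 < j)%N == b then x 0 j else 0).

Fact r22_pr_linear b : linear (r22_pr b).
Proof.
move=> k x y; apply/rowP => j; rewrite !mxE.
by case: eqP; rewrite ?mulr0 ?addr0.
Qed.
HB.instance Definition _ b :=
  GRing.isLinear.Build R 'rV[R]_4 'rV[R]_4 *:%R (r22_pr b) (r22_pr_linear b).

Fact r22_pr_pr a b x : r22_pr a (r22_pr b x) = if a == b then r22_pr b x else 0.
Proof.
apply/rowP => j; rewrite !mxE.
by case: a; case: b; rewrite /= !mxE; case: (1 < j)%N.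
Qed.

Fact r22_pr_sum x : r22_pr false x + r22_pr true x = x.
Proof.
by apply/rowP => j; rewrite !mxE; case: (1 < j)%N; rewrite /= ?addr0 ?add0r.
Qed.

Definition r22 : superspace R :=
  @Superspace R 'rV[R]_4 (fun b => r22_pr b) r22_pr_pr r22_pr_sum.

(* The basis is e_1, e_2 | e_3, e_4, the coordinate of index k : 'I_4 being the
   one on e_(k+1).  For 1 <= i <= j <= 4, [c i j k] is the coefficient of e_k in
   [e_i, e_j]; the values of [c] at i > j are not used. *)
Implicit Type c : nat -> nat -> nat -> R.

Definition sconst c (i j k : nat) : R :=
  if (i <= j)%N then c i j k
  else if (2 < i)%N && (2 < j)%N then c j i k else - c j i k.

Definition basis_br c (i j : nat) : r22 := \row_k sconst c i j k.+1.

Definition table_br c (x y : r22) : r22 :=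
  \sum_(i < 4) \sum_(j < 4) (x 0 i * y 0 j) *: basis_br c i.+1 j.+1.

Let e (k : nat) : r22 := \row_j (j.+1 == k)%:R.

Fact table_br_linear_l c y : linear (fun x => table_br c x y).
Proof.
move=> k x1 x2; rewrite /table_br scaler_sumr -big_split /=.
apply: eq_bigr => i _; rewrite scaler_sumr -big_split /=.
by apply: eq_bigr => j _; rewrite !mxE mulrDl scalerDl -mulrA scalerA.
Qed.

Fact table_br_linear_r c x : linear (table_br c x).
Proof.
move=> k x1 x2; rewrite /table_br scaler_sumr -big_split /=.
apply: eq_bigr => i _; rewrite scaler_sumr -big_split /=.
by apply: eq_bigr => j _; rewrite !mxE mulrDr scalerDl mulrCA scalerA.
Qed.

Let homog_coord b (x : r22) (i : 'I_4) :
  homog b x -> (1 < i)%N != b -> x 0 i = 0.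
Proof. by move=> <- hb; rewrite mxE (negbTE hb). Qed.

Definition table_even c := forall i j k : 'I_4, (i <= j)%N ->
  (1 < k)%N != (1 < i)%N (+) (1 < j)%N -> c i.+1 j.+1 k.+1 = 0.

Definition table_diag c := forall i k : 'I_4, (i < 2)%N ->
  c i.+1 i.+1 k.+1 = 0.

Definition table_jacobi c := forall i j k l : 'I_4,
  (i <= j)%N -> (j <= k)%N ->
  (1 < l)%N == (1 < i)%N (+) (1 < j)%N (+) (1 < k)%N ->
  let s i j k := sconst c i.+1 j.+1 k.+1 in
  let S f := f 0%N + f 1%N + f 2%N + f 3%N : R in
  S (fun m => s j k m * s i m l) =
    S (fun m => s i j m * s m k l)
    + (if (1 < i)%N && (1 < j)%N then -1 else 1) * S (fun m => s i k m * s j m l).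

Lemma homog_sumI (V : superspace R) b (I : finType) (F : I -> V) :
  (forall i, homog b (F i)) -> homog b (\sum_i F i).
Proof. by move=> h; rewrite /homog linear_sum; apply: eq_bigr => i _; exact: h. Qed.

Lemma basis_anti c : table_diag c -> forall i j : 'I_4,
  basis_br c i.+1 j.+1 =
    - ((-1) ^+ ((1 < i)%N && (1 < j)%N) *: basis_br c j.+1 i.+1).
Proof.
move=> dc i j; apply/rowP => k; rewrite !mxE /sconst !ltnS andbC.
case: (ltngtP i j) => [ij|ij|/val_inj<-].
- by case: ((1 < j)%N && (1 < i)%N); rewrite ?mulN1r ?mul1r opprK.
- by case: ((1 < j)%N && (1 < i)%N); rewrite ?mulN1r ?mul1r ?opprK.
- rewrite andbb; case: ltnP => i2; first by rewrite mulN1r opprK.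
  by rewrite dc // mulr0 oppr0.
Qed.

Lemma homog_basis c : table_even c -> forall i j : 'I_4,
  homog ((1 < i)%N (+) (1 < j)%N) (basis_br c i.+1 j.+1).
Proof.
move=> ec i j; apply/rowP => k; rewrite !mxE; case: eqP => // /eqP hk.
rewrite /sconst !ltnS; case: (leqP i j) => ij; first by rewrite ec.
rewrite addbC in hk.
by case: ifP => _; rewrite (ec _ _ _ (ltnW ij)) ?oppr0.
Qed.

Fact table_br_even c : table_even c -> forall a b x y,
  homog a x -> homog b y -> homog (a (+) b) (table_br c x y).
Proof.
move=> ec a b x y hx hy; apply: homog_sumI => i; apply: homog_sumI => j.
have [ia|ia] := eqVneq (1 < i)%N a; last first.
  by rewrite (homog_coord hx ia) mul0r scale0r /homog linear0.
have [jb|jb] := eqVneq (1 < j)%N b; last first.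
  by rewrite (homog_coord hy jb) mulr0 scale0r /homog linear0.
by apply: homogZ; rewrite -ia -jb; exact: homog_basis.
Qed.

Fact table_br_anti c : table_diag c -> forall a b x y,
  homog a x -> homog b y ->
  table_br c x y = - ((-1) ^+ (a && b) *: table_br c y x).
Proof.
move=> dc a b x y hx hy; rewrite /table_br exchange_big /= -scalerN -sumrN.
rewrite scaler_sumr; apply: eq_bigr => i _; rewrite -sumrN scaler_sumr.
apply: eq_bigr => j _.
have [ia|ia] := eqVneq (1 < j)%N a; last first.
  by rewrite (homog_coord hx ia) mul0r mulr0 !scale0r oppr0 scaler0.
have [jb|jb] := eqVneq (1 < i)%N b; last first.
  by rewrite (homog_coord hy jb) mul0r mulr0 !scale0r oppr0 scaler0.
rewrite basis_anti // ia jb !scalerN !scalerA; congr (- (_ *: _)).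
by rewrite mulrC [x _ _ * _]mulrC.
Qed.

Lemma table_br_sumr c x (I : finType) (d : I -> R) (F : I -> r22) :
  table_br c x (\sum_i d i *: F i) = \sum_i d i *: table_br c x (F i).
Proof.
elim/big_rec2: _ => [|i u v _ <-]; first exact: linear_zero (table_br_linear_r c x).
by rewrite table_br_linear_r.
Qed.

Lemma table_br_suml c y (I : finType) (d : I -> R) (F : I -> r22) :
  table_br c (\sum_i d i *: F i) y = \sum_i d i *: table_br c (F i) y.
Proof.
elim/big_rec2: _ => [|i u v _ <-]; first exact: linear_zero (table_br_linear_l c y).
exact: table_br_linear_l.
Qed.

Lemma rv_basis (x : r22) : x = \sum_(i < 4) x 0 i *: e i.+1.
Proof.
rewrite [LHS]row_sum_delta; apply: eq_bigr => i _; congr (_ *: _).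
by apply/rowP => j; rewrite !mxE eqxx.
Qed.

Lemma e_coord (i j : 'I_4) : e i.+1 0 j = (j == i)%:R.
Proof. by rewrite mxE eqSS. Qed.

Lemma table_brE c (i j : 'I_4) : table_br c (e i.+1) (e j.+1) = basis_br c i.+1 j.+1.
Proof.
rewrite /table_br (bigD1 i) //= (bigD1 j) //= !e_coord !eqxx mulr1 scale1r.
rewrite !big1 ?addr0 // => [k /negbTE ki|k /negbTE kj].
  by rewrite big1 // => l _; rewrite e_coord ki mul0r scale0r.
by rewrite !e_coord kj mulr0 scale0r.
Qed.

Lemma table_br_def c x y :
  table_br c x y = \sum_(i < 4) x 0 i *: \sum_(j < 4) y 0 j *: basis_br c i.+1 j.+1.
Proof.
apply: eq_bigr => i _; rewrite scaler_sumr.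
by apply: eq_bigr => j _; rewrite scalerA.
Qed.

Lemma table_br_el c (i : 'I_4) (x : r22) :
  table_br c (e i.+1) x = \sum_(m < 4) x 0 m *: basis_br c i.+1 m.+1.
Proof.
by rewrite {1}(rv_basis x) table_br_sumr; apply: eq_bigr => m _; rewrite table_brE.
Qed.

Lemma table_br_er c (i : 'I_4) (x : r22) :
  table_br c x (e i.+1) = \sum_(m < 4) x 0 m *: basis_br c m.+1 i.+1.
Proof.
by rewrite {1}(rv_basis x) table_br_suml; apply: eq_bigr => m _; rewrite table_brE.
Qed.

Let par (i : 'I_4) : bool := (1 < i)%N.

Let homog_e (i : 'I_4) : homog (par i) (e i.+1).
Proof.
apply/rowP => j; rewrite !mxE; case: eqP => // ij.
by case: eqP => // -[ji]; case: ij; rewrite /par -ji.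
Qed.

Let jac c (i j k : 'I_4) : Prop :=
  table_br c (e i.+1) (table_br c (e j.+1) (e k.+1)) =
    table_br c (table_br c (e i.+1) (e j.+1)) (e k.+1) +
    (-1) ^+ (par i && par j) *:
      table_br c (e j.+1) (table_br c (e i.+1) (e k.+1)).

Let jac_sorted c : table_even c -> table_jacobi c -> forall i j k : 'I_4,
  (i <= j)%N -> (j <= k)%N -> jac c i j k.
Proof.
move=> ec jc i j k ij jk; rewrite /jac.
have br2 a b x y hx hy := @table_br_even c ec a b x y hx hy.
have ei := homog_e i; have ej := homog_e j; have ek := homog_e k.
have h1 := br2 _ _ _ _ ei (br2 _ _ _ _ ej ek).
have h2 := br2 _ _ _ _ (br2 _ _ _ _ ei ej) ek.
have h3 := br2 _ _ _ _ ej (br2 _ _ _ _ ei ek).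
rewrite addbA in h1; rewrite addbCA addbA in h3.
apply/rowP => l; have [hl|hl] := boolP ((1 < l)%N == par i (+) par j (+) par k).
  have := jc i j k l ij jk hl.
  rewrite !table_brE !table_br_el table_br_er !mxE !summxE.
  rewrite !big_ord_recl !big_ord0 !mxE /= !addr0 !addrA => ->.
  by congr (_ + _ * _); rewrite -/(par i) -/(par j); case: ifP.
by rewrite !mxE (homog_coord h1 hl) (homog_coord h2 hl) (homog_coord h3 hl)
  mulr0 addr0.
Qed.

Let jac_swap12 c : table_diag c -> forall i j k, jac c i j k -> jac c j i k.
Proof.
move=> dc i j k; rewrite /jac => ->; rewrite andbC scalerDr scalerA.
rewrite -signr_addb addbb scale1r addrA.
rewrite (table_br_anti dc (homog_e j) (homog_e i)) andbC.
rewrite -scaleNr (linear_scale _ _ (table_br_linear_l c (e k.+1))) scaleNr.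
by rewrite addNr add0r.
Qed.

Let jac_swap23 c : table_even c -> table_diag c -> forall i j k,
  jac c i j k -> jac c i k j.
Proof.
move=> ec dc i j k; rewrite /jac.
have ei := homog_e i; have ej := homog_e j; have ek := homog_e k.
rewrite (table_br_anti dc ek ej) -scaleNr.
rewrite (linear_scale _ _ (table_br_linear_r c (e i.+1))) => ->.
rewrite (table_br_anti dc (table_br_even ec ei ek) ej).
rewrite (table_br_anti dc ek (table_br_even ec ei ej)).
set A := table_br _ _ _; set B := table_br _ _ _.
rewrite !(scaleNr, scalerDr, scalerN, opprD, scalerA) addrC.
by case: (par i); case: (par j); case: (par k);
  rewrite /= ?expr0 ?expr1 ?mulr1 ?mul1r ?mulrNN ?mulr1 ?scaleN1r ?scale1r.
Qed.

Let basis_jacobi c : table_even c -> table_diag c -> table_jacobi c ->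
  forall i j k, jac c i j k.
Proof.
move=> ec dc jc i j k.
have s12 := jac_swap12 dc; have s23 := jac_swap23 ec dc.
have js := jac_sorted ec jc.
case: (leqP i j) => [ij|/ltnW ji]; case: (leqP j k) => [jk|/ltnW kj];
  case: (leqP i k) => [ik|/ltnW ki].
- exact: js.
- exact: js.
- exact/s23/js.
- exact/s23/s12/js.
- exact/s12/js.
- exact/s12/s23/js.
- exact/s12/s23/s12/js.
- exact/s12/s23/s12/js.
Qed.

Fact table_br_jacobi c : table_even c -> table_diag c -> table_jacobi c ->
  forall a b d x y z,
  homog a x -> homog b y -> homog d z ->
  table_br c x (table_br c y z) =
    table_br c (table_br c x y) z + (-1) ^+ (a && b) *: table_br c y (table_br c x z).
Proof.
move=> ec dc jc a b d x y z hx hy _.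
rewrite {1}(rv_basis x) table_br_suml.
rewrite [table_br c x y]table_br_def table_br_suml.
rewrite [table_br c x z]table_br_def table_br_sumr scaler_sumr -big_split /=.
apply: eq_bigr => i _; rewrite [RHS]addrC scalerA mulrC -scalerA -scalerDr.
have [ia|ia] := eqVneq (1 < i)%N a; last by rewrite (homog_coord hx ia) !scale0r.
congr (_ *: _); rewrite [table_br c y z]table_br_def table_br_sumr table_br_suml.
rewrite [X in table_br c X (\sum_(k < 4) _)](rv_basis y) table_br_suml scaler_sumr -big_split /=.
apply: eq_bigr => j _; rewrite scalerA [_ * y 0 j]mulrC -scalerA -scalerDr.
have [jb|jb] := eqVneq (1 < j)%N b; last by rewrite (homog_coord hy jb) !scale0r.
congr (_ *: _); rewrite !table_br_sumr [X in table_br c (basis_br _ _ _) X](rv_basis z).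
rewrite table_br_sumr.
rewrite scaler_sumr -big_split /=; apply: eq_bigr => k _.
rewrite scalerA [_ * z 0 k]mulrC -scalerA -scalerDr.
congr (_ *: _); rewrite -ia -jb [RHS]addrC.
by have := basis_jacobi ec dc jc i j k; rewrite /jac !table_brE.
Qed.

Definition table_alg c (ec : table_even c) (dc : table_diag c)
    (jc : table_jacobi c) : lieSuperalg R :=
  LieSuperalg (table_br_linear_l c) (table_br_linear_r c) (table_br_even ec)
    (table_br_anti dc) (table_br_jacobi ec dc jc).

End Tables.


Ltac ord4 := case=> [[|[|[|[|?]]]] //= ?].
Ltac prove_even := rewrite /table_even; do 3 ord4.
Ltac prove_diag := rewrite /table_diag; do 2 ord4.
Ltac prove_jacobi :=
  rewrite /table_jacobi; do 4 (case=> [[|[|[|[|?]]]] //= ?]);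
  rewrite /sconst /=; lra.

(* Notation: [D8_m1] is D^8_{-1}, [D7_half_i] is (D^7_{1/2,1/2})^i, [D7_1mp_p p]
   is (D^7_{1-p,p}), [D9_half p] is (D^9_{1/2,p}), [D10_0_i] is (D^10_0)^i,
   [A11_2A_3 p] is (2A_{1,1}+2A)^3_p, [C1_1_A] is (C^1_1+A), [C1_half_A] is
   (C^1_{1/2}+A) and [C3_A] is (C^3+A).  [D7 p q] is a Lie superalgebra for all
   p and q, although D^7_{pq} is only considered for pq <> 0. *)
Section Algebras.
Variable R : realType.
Local Notation table := (nat -> nat -> nat -> R).

Definition D5_table : table := fun i j k =>
  match i, j, k with
  | 1, 3, 3 => 1
  | 1, 4, 4 => 1
  | 2, 4, 3 => 1
  | _, _, _ => 0
  end.
Fact D5_even : table_even D5_table. Proof. prove_even. Qed.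
Fact D5_diag : table_diag D5_table. Proof. prove_diag. Qed.
Fact D5_jacobi : table_jacobi D5_table. Proof. prove_jacobi. Qed.
Definition D5 : lieSuperalg R :=
  table_alg D5_even D5_diag D5_jacobi.

Definition D6_table : table := fun i j k =>
  match i, j, k with
  | 1, 3, 3 => 1
  | 1, 4, 4 => 1
  | 2, 3, 4 => -1
  | 2, 4, 3 => 1
  | _, _, _ => 0
  end.
Fact D6_even : table_even D6_table. Proof. prove_even. Qed.
Fact D6_diag : table_diag D6_table. Proof. prove_diag. Qed.
Fact D6_jacobi : table_jacobi D6_table. Proof. prove_jacobi. Qed.
Definition D6 : lieSuperalg R :=
  table_alg D6_even D6_diag D6_jacobi.

Definition D7_table (p q : R) : table := fun i j k =>
  match i, j, k with
  | 1, 2, 2 => 1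
  | 1, 3, 3 => p
  | 1, 4, 4 => q
  | _, _, _ => 0
  end.
Fact D7_even p q : table_even (D7_table p q). Proof. prove_even. Qed.
Fact D7_diag p q : table_diag (D7_table p q). Proof. prove_diag. Qed.
Fact D7_jacobi p q : table_jacobi (D7_table p q). Proof. prove_jacobi. Qed.
Definition D7 (p q : R) : lieSuperalg R :=
  table_alg (D7_even p q) (D7_diag p q) (D7_jacobi p q).

Definition D8_m1_table : table := fun i j k =>
  match i, j, k with
  | 1, 2, 2 => 1
  | 1, 3, 3 => -1
  | 1, 4, 3 => 1
  | 1, 4, 4 => -1
  | _, _, _ => 0
  end.
Fact D8_m1_even : table_even D8_m1_table. Proof. prove_even. Qed.
Fact D8_m1_diag : table_diag D8_m1_table. Proof. prove_diag. Qed.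
Fact D8_m1_jacobi : table_jacobi D8_m1_table. Proof. prove_jacobi. Qed.
Definition D8_m1 : lieSuperalg R :=
  table_alg D8_m1_even D8_m1_diag D8_m1_jacobi.

Definition D10_table (q : R) : table := fun i j k =>
  match i, j, k with
  | 1, 2, 2 => 1
  | 1, 3, 3 => q + 1
  | 1, 4, 4 => q
  | 2, 4, 3 => 1
  | _, _, _ => 0
  end.
Fact D10_even q : table_even (D10_table q). Proof. prove_even. Qed.
Fact D10_diag q : table_diag (D10_table q). Proof. prove_diag. Qed.
Fact D10_jacobi q : table_jacobi (D10_table q). Proof. prove_jacobi. Qed.
Definition D10 (q : R) : lieSuperalg R :=
  table_alg (D10_even q) (D10_diag q) (D10_jacobi q).

Definition D7_half_1_table : table := fun i j k =>
  match i, j, k with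
  | 1, 2, 2 => 1
  | 1, 3, 3 => 1 / 2
  | 1, 4, 4 => 1 / 2
  | 3, 3, 2 => 1
  | 4, 4, 2 => 1
  | _, _, _ => 0
  end.
Fact D7_half_1_even : table_even D7_half_1_table. Proof. prove_even. Qed.
Fact D7_half_1_diag : table_diag D7_half_1_table. Proof. prove_diag. Qed.
Fact D7_half_1_jacobi : table_jacobi D7_half_1_table. Proof. prove_jacobi. Qed.
Definition D7_half_1 : lieSuperalg R :=
  table_alg D7_half_1_even D7_half_1_diag D7_half_1_jacobi.

Definition D7_half_2_table : table := fun i j k =>
  match i, j, k with
  | 1, 2, 2 => 1
  | 1, 3, 3 => 1 / 2
  | 1, 4, 4 => 1 / 2
  | 3, 3, 2 => 1
  | 4, 4, 2 => -1
  | _, _, _ => 0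
  end.
Fact D7_half_2_even : table_even D7_half_2_table. Proof. prove_even. Qed.
Fact D7_half_2_diag : table_diag D7_half_2_table. Proof. prove_diag. Qed.
Fact D7_half_2_jacobi : table_jacobi D7_half_2_table. Proof. prove_jacobi. Qed.
Definition D7_half_2 : lieSuperalg R :=
  table_alg D7_half_2_even D7_half_2_diag D7_half_2_jacobi.

Definition D7_1mp_p_table (p : R) : table := fun i j k =>
  match i, j, k with
  | 1, 2, 2 => 1
  | 1, 3, 3 => p
  | 1, 4, 4 => 1 - p
  | 3, 4, 2 => 1
  | _, _, _ => 0
  end.
Fact D7_1mp_p_even p : table_even (D7_1mp_p_table p). Proof. prove_even. Qed.
Fact D7_1mp_p_diag p : table_diag (D7_1mp_p_table p). Proof. prove_diag. Qed.
Fact D7_1mp_p_jacobi p : table_jacobi (D7_1mp_p_table p). Proof. prove_jacobi. Qed.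
Definition D7_1mp_p (p : R) : lieSuperalg R :=
  table_alg (D7_1mp_p_even p) (D7_1mp_p_diag p) (D7_1mp_p_jacobi p).

Definition D9_half_table (p : R) : table := fun i j k =>
  match i, j, k with
  | 1, 2, 2 => 1
  | 1, 3, 3 => 1 / 2
  | 1, 3, 4 => - p
  | 1, 4, 3 => p
  | 1, 4, 4 => 1 / 2
  | 3, 3, 2 => 1
  | 4, 4, 2 => 1
  | _, _, _ => 0
  end.
Fact D9_half_even p : table_even (D9_half_table p). Proof. prove_even. Qed.
Fact D9_half_diag p : table_diag (D9_half_table p). Proof. prove_diag. Qed.
Fact D9_half_jacobi p : table_jacobi (D9_half_table p). Proof. prove_jacobi. Qed.
Definition D9_half (p : R) : lieSuperalg R :=
  table_alg (D9_half_even p) (D9_half_diag p) (D9_half_jacobi p).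

Definition D10_0_1_table : table := fun i j k =>
  match i, j, k with
  | 1, 2, 2 => 1
  | 1, 3, 3 => 1
  | 2, 4, 3 => 1
  | 4, 4, 1 => 1
  | 3, 4, 2 => - (1 / 2)
  | _, _, _ => 0
  end.
Fact D10_0_1_even : table_even D10_0_1_table. Proof. prove_even. Qed.
Fact D10_0_1_diag : table_diag D10_0_1_table. Proof. prove_diag. Qed.
Fact D10_0_1_jacobi : table_jacobi D10_0_1_table. Proof. prove_jacobi. Qed.
Definition D10_0_1 : lieSuperalg R :=
  table_alg D10_0_1_even D10_0_1_diag D10_0_1_jacobi.

Definition D10_0_2_table : table := fun i j k =>
  match i, j, k with
  | 1, 2, 2 => 1
  | 1, 3, 3 => 1
  | 2, 4, 3 => 1
  | 4, 4, 1 => -1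
  | 3, 4, 2 => 1 / 2
  | _, _, _ => 0
  end.
Fact D10_0_2_even : table_even D10_0_2_table. Proof. prove_even. Qed.
Fact D10_0_2_diag : table_diag D10_0_2_table. Proof. prove_diag. Qed.
Fact D10_0_2_jacobi : table_jacobi D10_0_2_table. Proof. prove_jacobi. Qed.
Definition D10_0_2 : lieSuperalg R :=
  table_alg D10_0_2_even D10_0_2_diag D10_0_2_jacobi.

Definition A11_2A_3_table (p : R) : table := fun i j k =>
  match i, j, k with
  | 3, 3, 1 => 1
  | 4, 4, 2 => 1
  | 3, 4, 1 => p
  | 3, 4, 2 => p
  | _, _, _ => 0
  end.
Fact A11_2A_3_even p : table_even (A11_2A_3_table p). Proof. prove_even. Qed.
Fact A11_2A_3_diag p : table_diag (A11_2A_3_table p). Proof. prove_diag. Qed.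
Fact A11_2A_3_jacobi p : table_jacobi (A11_2A_3_table p). Proof. prove_jacobi. Qed.
Definition A11_2A_3 (p : R) : lieSuperalg R :=
  table_alg (A11_2A_3_even p) (A11_2A_3_diag p) (A11_2A_3_jacobi p).

Definition C1_1_A_table : table := fun i j k =>
  match i, j, k with
  | 1, 2, 2 => 1
  | 1, 3, 3 => 1
  | 3, 4, 2 => 1
  | _, _, _ => 0
  end.
Fact C1_1_A_even : table_even C1_1_A_table. Proof. prove_even. Qed.
Fact C1_1_A_diag : table_diag C1_1_A_table. Proof. prove_diag. Qed.
Fact C1_1_A_jacobi : table_jacobi C1_1_A_table. Proof. prove_jacobi. Qed.
Definition C1_1_A : lieSuperalg R :=
  table_alg C1_1_A_even C1_1_A_diag C1_1_A_jacobi.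

Definition C1_half_A_table : table := fun i j k =>
  match i, j, k with
  | 1, 2, 2 => 1
  | 1, 3, 3 => 1 / 2
  | 3, 3, 2 => 1
  | _, _, _ => 0
  end.
Fact C1_half_A_even : table_even C1_half_A_table. Proof. prove_even. Qed.
Fact C1_half_A_diag : table_diag C1_half_A_table. Proof. prove_diag. Qed.
Fact C1_half_A_jacobi : table_jacobi C1_half_A_table. Proof. prove_jacobi. Qed.
Definition C1_half_A : lieSuperalg R :=
  table_alg C1_half_A_even C1_half_A_diag C1_half_A_jacobi.

Definition C3_A_table : table := fun i j k =>
  match i, j, k with
  | 1, 4, 3 => 1
  | 4, 4, 2 => 1
  | _, _, _ => 0
  end.
Fact C3_A_even : table_even C3_A_table. Proof. prove_even. Qed.
Fact C3_A_diag : table_diag C3_A_table. Proof. prove_diag. Qed.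
Fact C3_A_jacobi : table_jacobi C3_A_table. Proof. prove_jacobi. Qed.
Definition C3_A : lieSuperalg R :=
  table_alg C3_A_even C3_A_diag C3_A_jacobi.

End Algebras.

(* Main.v *)
From HB Require Import structures.
Require Import Defs.
From mathcomp Require Import all_boot all_order all_algebra.
From mathcomp Require Import reals.
From mathcomp Require Import ring lra.

Set Implicit Arguments.
Unset Strict Implicit.
Unset Printing Implicit Defensive.

Import Order.TTheory GRing.Theory Num.Theory.
Local Open Scope ring_scope.

(** The two kinds of Lagrangian extensions are treated together, the parity eps
    of the canonical form telling them apart.

    Let g carry a closed non-degenerate anti-symmetric form w of parity eps, an
    isotropic ideal I, and an isotropic graded complement s(V) of I with
    dim g = 2 dim V. Then g is a Lagrangian extension of g / I
    (lagrangian_splittingP). Indeed w identifies I with the dual of V, shifted in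
    parity if w is odd; closedness makes I abelian; the connection is the
    transpose of the right action of s(V) on I,
      w(n, s(nabla_u v)) = w([n, s(u)], s(v))   for n in I,
    which is torsion-free because w is closed and flat by the Jacobi identity;
    the cocycle is the component of [s(u), s(v)] in I, and its cyclic condition
    is closedness of w on s(V).

    For the algebras of (i) and (ii) it remains to exhibit w and I. When I is
    spanned by two vectors of the basis this is a finite computation with the
    structure constants (table_lagrangian). The ideal is spanned by e2, e3 for
    all algebras of (i) but one, and by e3, e4, or e2, e3, or e1, e2 in (ii). The
    remaining algebra (D^7_{1/2,1/2})^2 has [x, x] = (x3^2 - x4^2) e2 on its odd
    part, and a null basis of this indefinite quadratic form identifies it with
    (D^7_{1-p,p}) for p = 1/2.

    For (iii), a Lagrangian extension carries a form w as above
    (lagrangian_extension_form). In the case of T* the ideal and the quotient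
    have the same odd dimension, so that the ideal contains an odd x <> 0 as soon
    as the algebra has an odd part, and then [x, x] = 0 and w(x, x) = 0. The
    exceptional algebras satisfy [e3, e3] = e2 and [e3, e4] = 0, which puts e2
    in the kernel of every odd closed form (not_PiTstar). On the odd part,
    [x, x] = (x3^2 + x4^2) e2 in two of the three cases, and no x exists
    (not_Tstar_definite); for (C^1_{1/2}+A) it is x3^2 e2, so x is a multiple of
    e4, but closedness makes e4 orthogonal to e3 as well, and w would be
    degenerate (not_Tstar_degenerate). *)

(** * Lagrangian extensions of both parities *)

Section LagrangianDual.
Variables (R : realType) (eps : bool).

(** The module of which extensions are made: eps is the parity of its pairing
    with V. *)
Definition lag_dual (V : superspace R) : superspace R :=
  if eps then Pi (dual V) else dual V.

Definition lag_ev (V : superspace R) : lag_dual V -> 'Hom(V, R^o) :=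
  match eps as e return (if e then Pi (dual V) else dual V) -> 'Hom(V, R^o)
  with true => fun m => m | false => fun m => m end.

Definition lag_of (V : superspace R) : 'Hom(V, R^o) -> lag_dual V :=
  match eps as e return 'Hom(V, R^o) -> (if e then Pi (dual V) else dual V)
  with true => fun m => m | false => fun m => m end.

Definition lag_rep (h : lieSuperalg R) (D : flat_connection h) :
    rep h (lag_dual h) :=
  match eps as e return rep h (if e then Pi (dual h) else dual h)
  with true => chi D | false => rho D end.

End LagrangianDual.

Arguments lag_ev : simpl never.
Arguments lag_of : simpl never.
Arguments lag_dual : simpl never.

Section LagrangianDualTheory.
Variables (R : realType) (eps : bool) (V : superspace R).
Implicit Types (m : lag_dual eps V) (xi : 'Hom(V, R^o)).

Lemma lag_evK : cancel (@lag_ev R eps V) (@lag_of R eps V).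
Proof. by rewrite /lag_ev /lag_of /lag_dual; case: eps. Qed.

Lemma lag_ofK : cancel (@lag_of R eps V) (@lag_ev R eps V).
Proof. by rewrite /lag_ev /lag_of /lag_dual; case: eps. Qed.

Lemma lag_ev_linear : linear (@lag_ev R eps V).
Proof. by rewrite /lag_ev /lag_dual; case: eps. Qed.

Lemma lag_of_linear : linear (@lag_of R eps V).
Proof. by rewrite /lag_of /lag_dual; case: eps. Qed.

Lemma dim_lag_dual : \dim {: lag_dual eps V} = \dim {: V}.
Proof.
have dimE : \dim {: 'Hom(V, R^o)} = \dim {: V} by rewrite !dimvf; exact: muln1.
by rewrite /lag_dual; case: eps.
Qed.

Lemma homog_lag_dualP b m :
  homog b m <-> (forall x, homog (~~ (b (+) eps)) x -> lag_ev m x = 0).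
Proof.
have dualP (c : bool) (xi : dual V) :
    homog c xi <-> (forall x, homog (~~ c) x -> ev xi x = 0).
  rewrite /homog /ev /=; split=> [<- x hx|e].
    rewrite comp_lfunE lfunE /= (homog_prE _ hx).
    by case: c {hx}; rewrite linear0.
  apply/lfunP => x; rewrite comp_lfunE lfunE /= -{2}(pr_sum x) linearD.
  by case: c e => e; have /= -> := e _ (homog_pr _ x); rewrite ?add0r ?addr0.
move: m; rewrite /lag_ev /lag_dual; case: eps => m.
  have := dualP (~~ b) (ofPi m); rewrite addbT negbK => -[h1 h2].
  by split=> [hm x hx|h]; [exact: h1|apply: h2 => x; exact: h].
have := dualP b m; rewrite addbF => -[h1 h2].
by split=> [hm x hx|h]; [exact: h1|exact: h2].
Qed.

End LagrangianDualTheory.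

HB.instance Definition _ (R : realType) eps (V : superspace R) :=
  GRing.isLinear.Build R (lag_dual eps V) 'Hom(V, R^o) *:%R (@lag_ev R eps V)
    (@lag_ev_linear R eps V).
HB.instance Definition _ (R : realType) eps (V : superspace R) :=
  GRing.isLinear.Build R 'Hom(V, R^o) (lag_dual eps V) *:%R (@lag_of R eps V)
    (@lag_of_linear R eps V).

Section LagrangianEval.
Variables (R : realType) (eps : bool) (V : superspace R).
Implicit Types m n : lag_dual eps V.

Lemma lag_evD m n v : lag_ev (m + n) v = lag_ev m v + lag_ev n v.
Proof. by rewrite linearD add_lfunE. Qed.

Lemma lag_evN m v : lag_ev (- m) v = - lag_ev m v.
Proof. by rewrite linearN opp_lfunE. Qed.

Lemma lag_evZ k m v : lag_ev (k *: m) v = k * lag_ev m v.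
Proof. by rewrite linearZ scale_lfunE. Qed.

Lemma lag_evDr m u v : lag_ev m (u + v) = lag_ev m u + lag_ev m v.
Proof. exact: linearD. Qed.

Lemma lag_evZr k m v : lag_ev m (k *: v) = k * lag_ev m v.
Proof. exact: linearZ. Qed.

Lemma lag_ev_parity a b m u : homog a m -> homog b u ->
  a (+) b != eps -> lag_ev m u = 0.
Proof.
move=> /homog_lag_dualP hm hu ab; apply: hm; move: hu.
by case: a ab; case: b; case: eps.
Qed.

End LagrangianEval.

Section LagrangianExtensions.
Variables (R : realType) (eps : bool).

(** Writing |m| for the parity in the module, the signs in the definitions of
    rho and of chi both amount to [u, m] = -(-1)^(|u||m|) m o nabla_u. *)
Lemma lag_ev_rep (h : lieSuperalg R) (D : flat_connection h) a b u
    (m : lag_dual eps h) v : homog a u -> homog b m ->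
  lag_ev (lag_rep eps D u m) v = - ((-1) ^+ (a && b) * lag_ev m (D u v)).
Proof.
move=> hu; move: m; rewrite /lag_rep /lag_ev /lag_dual; case: eps => m hm.
  have {}hm : homog (~~ b) (ofPi m) by [].
  change (ev (chi_act D u m) v = - ((-1) ^+ (a && b) * ev (ofPi m) (D u v))).
  rewrite (chi_actE _ _ hu) (rho_actE _ hu hm) /ev /= scale_lfunE.
  rewrite opp_lfunE scale_lfunE comp_lfunE /GRing.scale /=.
  by case: a {hu}; case: b {hm}; rewrite /= ?expr0 ?expr1; ring.
change (ev (rho_act D u m) v = - ((-1) ^+ (a && b) * ev m (D u v))).
by rewrite (rho_actE _ hu hm) /ev opp_lfunE scale_lfunE comp_lfunE.
Qed.

Definition lag_cyclic (h : lieSuperalg R) (D : flat_connection h)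
    (c : cocycle2 (lag_rep eps D)) : Prop :=
  forall i j k u v w, homog i u -> homog j v -> homog k w ->
    (-1) ^+ (i && k) * lag_ev (c u v) w
      + (-1) ^+ (j && i) * lag_ev (c v w) u
      + (-1) ^+ (k && j) * lag_ev (c w u) v = 0.

(** By conversion, a T*-extension for eps = false and a PiT*-extension for
    eps = true. *)
Definition is_lagrangian_extension (g h : lieSuperalg R) : Prop :=
  exists (D : flat_connection h) (c : cocycle2 (lag_rep eps D)),
    lag_cyclic c /\ isomorphic g (abelian_ext c).

End LagrangianExtensions.

(** * Bilinearity and homogeneous components *)

Section Bilinear.
Variables (R : realType) (g : lieSuperalg R).
Implicit Types x y z : g.

Lemma brDl x y z : br (x + y) z = br x z + br y z.
Proof. by have := br_linear_l z 1 x y; rewrite !scale1r. Qed.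

Lemma brDr x y z : br x (y + z) = br x y + br x z.
Proof. by have := br_linear_r x 1 y z; rewrite !scale1r. Qed.

Lemma brZr k x y : br x (k *: y) = k *: br x y.
Proof. exact: linear_scale (br_linear_r x). Qed.

Lemma brZl k x y : br (k *: x) y = k *: br x y.
Proof. exact: (linear_scale k x (br_linear_l y)). Qed.

Lemma brNr x y : br x (- y) = - br x y.
Proof. by rewrite -scaleN1r brZr scaleN1r. Qed.

Lemma br0r x : br x 0 = 0.
Proof. exact: linear_zero (br_linear_r x). Qed.

End Bilinear.

Section BilinearForm.
Variables (R : realType) (g : lieSuperalg R) (w : 'Hom(g, 'Hom(g, R^o))).
Implicit Types x y z : g.

Lemma form_Dl x y z : w (x + y) z = w x z + w y z.
Proof. by rewrite linearD add_lfunE. Qed.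

Lemma form_Dr x y z : w x (y + z) = w x y + w x z.
Proof. exact: linearD. Qed.

Lemma form_Nr x y : w x (- y) = - w x y.
Proof. exact: linearN. Qed.

Lemma form_Zr k x y : w x (k *: y) = k * w x y.
Proof. exact: linearZ. Qed.

Lemma form_Zl k x y : w (k *: x) y = k * w x y.
Proof. by rewrite linearZ scale_lfunE. Qed.

Lemma form_Nl x z : w (- x) z = - w x z.
Proof. by rewrite linearN opp_lfunE. Qed.

End BilinearForm.

Section HomogeneousInduction.
Variables (R : realType) (V : superspace R).

Lemma homog_ind (P : V -> Prop) :
  (forall x y, P x -> P y -> P (x + y)) ->
  (forall b x, homog b x -> P x) -> forall x, P x.
Proof.
move=> PD Ph x; rewrite -(pr_sum x).
by apply: PD; [exact: Ph (homog_pr _ _)|exact: Ph (homog_pr _ _)].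
Qed.

End HomogeneousInduction.

Lemma even_pr (R : realType) (U V : superspace R) (f : 'Hom(U, V)) :
  (forall b x, homog b x -> homog b (f x)) ->
  forall b x, f (pr U b x) = pr V b (f x).
Proof.
move=> fe b x; rewrite -{2}(pr_sum x) !linearD /=.
rewrite !(homog_prE _ (fe _ _ (homog_pr _ _))).
by case: b; rewrite /= ?addr0 ?add0r.
Qed.

(** A linear functional on the dual is evaluation at a vector; the vector is
    written on a basis, so that it is linear in the functional. *)
Section DoubleDual.
Variables (R : realType) (V : vectType R).

Definition bidual_vec (F : 'Hom(V, R^o) -> R) : V :=
  \sum_(k < \dim {: V})
     F (linfun (coord (vbasis {: V}) k : V -> R^o)) *: (vbasis {: V})`_k.

Lemma bidual_vecE (F : 'Hom(V, R^o) -> R) (xi : 'Hom(V, R^o)) :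
  (forall a x y, F (a *: x + y) = a * F x + F y) -> xi (bidual_vec F) = F xi.
Proof.
move=> Fl.
have F0 : F 0 = 0.
  by apply: (addIr (F 0)); have := Fl 1 0 0; rewrite scale1r mul1r addr0 add0r.
have Fsum n (a : 'I_n -> R) (x : 'I_n -> 'Hom(V, R^o)) :
    F (\sum_k a k *: x k) = \sum_k a k * F (x k).
  by elim/big_rec2: _ => // k u v _ <-; exact: Fl.
have {2}-> : xi = \sum_(k < \dim {: V})
    xi (vbasis {: V})`_k *: linfun (coord (vbasis {: V}) k : V -> R^o).
  apply/lfunP => v; rewrite {1}(coord_vbasis (memvf v)) linear_sum sum_lfunE.
  by apply: eq_bigr => k _; rewrite linearZ scale_lfunE lfunE; exact: mulrC.
rewrite Fsum linear_sum; apply: eq_bigr => k _.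
by rewrite linearZ; exact: mulrC.
Qed.

End DoubleDual.

Lemma ract_homog (R : realType) (h : lieSuperalg R) (M : superspace R)
    (r : rep h M) a b (m : M) (v : h) : homog b m -> homog a v ->
  ract r m v = - ((-1) ^+ (a && b) *: r v m).
Proof.
move=> hm hv; have r0 u : r u 0 = 0 by exact: linear_zero (act_linear_r r u).
have r0l n : r 0 n = 0 by exact: (linear_zero (act_linear_l r n)).
rewrite /ract !big_bool !(homog_prE _ hm) !(homog_prE _ hv).
by case: a hv => hv; case: b hm => hm /=;
  rewrite ?r0 ?r0l ?scaler0 ?addr0 ?add0r.
Qed.

(** * Forms with a Lagrangian ideal *)

Section Splitting.
Variables (R : realType) (eps : bool) (g : lieSuperalg R).
Variables (w : 'Hom(g, 'Hom(g, R^o))) (V : superspace R).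
Variables (s : 'Hom(V, g)) (p : 'Hom(g, V)).

Definition parity_form : Prop :=
  forall a b x y, homog a x -> homog b y -> a (+) b != eps -> w x y = 0.

(** The Lagrangian ideal is the kernel of p, and s is a section of p onto an
    isotropic complement. The dimension makes the ideal pair with V onto the
    whole dual of V. *)
Record lagrangian_splitting : Prop := LagrangianSplitting {
  spl_anti : antisymmetric_form w;
  spl_closed : closed_form w;
  spl_nondeg : nondegenerate_form w;
  spl_parity : parity_form;
  spl_s : forall b u, homog b u -> homog b (s u);
  spl_p : forall b x, homog b x -> homog b (p x);
  spl_ps : cancel s p;
  spl_ideal : forall x n, p n = 0 -> p (br x n) = 0;
  spl_ideal_isotropic : forall m n, p m = 0 -> p n = 0 -> w m n = 0;
  spl_section_isotropic : forall u v, w (s u) (s v) = 0;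
  spl_dim : \dim {: g} = (\dim {: V} + \dim {: V})%N }.

Hypothesis H : lagrangian_splitting.

Lemma ker_ind (P : g -> Prop) :
  (forall x y, P x -> P y -> P (x + y)) ->
  (forall b n, homog b n -> p n = 0 -> P n) -> forall n, p n = 0 -> P n.
Proof.
move=> PD Ph n pn; rewrite -(pr_sum n).
by apply: PD; apply: (Ph _ _ (homog_pr _ _)); rewrite (even_pr (spl_p H)) pn linear0.
Qed.

(** Non-degeneracy is assumed on the left; a form of pure parity is
    anti-symmetric one homogeneous component at a time. *)
Lemma nondeg_r y : (forall x, w x y = 0) -> y = 0.
Proof.
move=> wy; suff wpy b : pr g b y = 0 by rewrite -(pr_sum y) !wpy addr0.
apply: (spl_nondeg H); apply: homog_ind => [x z hx hz|a x hx].
  by rewrite form_Dr hx hz addr0.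
rewrite (spl_anti H (homog_pr b y) hx).
have [ab|ab] := eqVneq (a (+) b) eps; last first.
  by rewrite (spl_parity H hx (homog_pr b y) ab) mulr0 oppr0.
suff -> : w x (pr g b y) = w x y by rewrite wy mulr0 oppr0.
rewrite -{2}(pr_sum y) form_Dr.
have ne : a (+) ~~ b != eps by rewrite -ab addbN; case: (_ (+) _).
have := spl_parity H hx (homog_pr (~~ b) y) ne.
by case: b {ab ne} => /= ->; rewrite ?add0r ?addr0.
Qed.

Lemma ideal_l n x : p n = 0 -> p (br n x) = 0.
Proof.
move=> pn; move: x; apply: homog_ind => [x y hx hy|a x hx].
  by rewrite brDr linearD /= hx hy addr0.
move: n pn; apply: ker_ind => [m n hm hn|b n hn pn].
  by rewrite brDl linearD /= hm hn addr0.
by rewrite (br_anti hn hx) linearN linearZ /= (spl_ideal H) // scaler0 oppr0.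
Qed.

(** Closedness pairs [I, I] with g to zero as soon as I is an isotropic
    ideal. *)
Lemma ker_abelian m n : p m = 0 -> p n = 0 -> br m n = 0.
Proof.
move=> pm pn; move: m pm; apply: ker_ind => [m m' hm hm'|a m hm pm].
  by rewrite brDl hm hm' addr0.
move: n pn; apply: ker_ind => [n n' hn hn'|b n hn pn].
  by rewrite brDr hn hn' addr0.
apply: nondeg_r; apply: homog_ind => [x y hx hy|c x hx].
  by rewrite form_Dl hx hy addr0.
have := spl_closed H hm hn hx.
rewrite (spl_ideal_isotropic H pm (ideal_l _ pn)) (spl_ideal_isotropic H pn (spl_ideal H _ pm)).
rewrite !mulr0 add0r addr0 => /eqP.
by rewrite mulf_eq0 signr_eq0 => /eqP.
Qed.

(** The section pairs trivially with itself, hence it pairs perfectly with the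
    ideal. *)
Lemma section_sep u : (forall n, p n = 0 -> w n (s u) = 0) -> u = 0.
Proof.
move=> wu; rewrite -(spl_ps H u); suff -> : s u = 0 by rewrite linear0.
apply: nondeg_r => x.
have -> : x = s (p x) + (x - s (p x)) by rewrite addrC subrK.
by rewrite form_Dl (spl_section_isotropic H) add0r wu // linearB /= (spl_ps H) subrr.
Qed.

Definition vert x : g := x - s (p x).

Lemma p_vert x : p (vert x) = 0.
Proof. by rewrite linearB /= (spl_ps H) subrr. Qed.

Lemma vertE x : x = s (p x) + vert x.
Proof. by rewrite addrC subrK. Qed.

Lemma p_br_sp x y : p (br x (s (p y))) = p (br x y).
Proof. by rewrite [in RHS](vertE y) brDr linearD /= (spl_ideal H _ (p_vert y)) addr0. Qed.

Lemma p_br_spl x y : p (br (s (p x)) y) = p (br x y).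
Proof. by rewrite [in RHS](vertE x) brDl linearD /= (ideal_l _ (p_vert x)) addr0. Qed.

(** * The quotient by the ideal, carried by the section *)

Definition quot_br (u v : V) : V := p (br (s u) (s v)).

Fact quot_linear_l v : linear (fun u => quot_br u v).
Proof. by move=> k x y; rewrite /quot_br linearP brDl brZl; exact: linearP. Qed.

Fact quot_linear_r u : linear (quot_br u).
Proof. by move=> k x y; rewrite /quot_br linearP brDr brZr; exact: linearP. Qed.

Fact quot_even a b u v : homog a u -> homog b v -> homog (a (+) b) (quot_br u v).
Proof. by move=> hu hv; apply: (spl_p H); apply: br_even; apply: (spl_s H). Qed.

Fact quot_anti a b u v : homog a u -> homog b v ->
  quot_br u v = - ((-1) ^+ (a && b) *: quot_br v u).
Proof.
move=> hu hv; rewrite /quot_br (br_anti (spl_s H hu) (spl_s H hv)).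
by rewrite linearN linearZ.
Qed.

Fact quot_jacobi a b c x y z : homog a x -> homog b y -> homog c z ->
  quot_br x (quot_br y z) =
    quot_br (quot_br x y) z + (-1) ^+ (a && b) *: quot_br y (quot_br x z).
Proof.
move=> hx hy hz; rewrite /quot_br !p_br_sp p_br_spl.
by rewrite (br_jacobi (spl_s H hx) (spl_s H hy) (spl_s H hz)) linearD linearZ.
Qed.

Definition quot : lieSuperalg R :=
  LieSuperalg quot_linear_l quot_linear_r quot_even quot_anti quot_jacobi.

(** * The ideal as the dual of the quotient *)

Definition to_dual (x : g) : lag_dual eps V := lag_of eps (w x \o s)%VF.

Lemma to_dualE x v : lag_ev (to_dual x) v = w x (s v).
Proof. by rewrite /to_dual lag_ofK comp_lfunE. Qed.

Lemma to_dual_linear : linear to_dual.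
Proof. by move=> k x y; rewrite /to_dual linearP comp_lfunDl -comp_lfunZl linearP. Qed.
HB.instance Definition _ := GRing.isLinear.Build R g (lag_dual eps V) *:%R
  to_dual to_dual_linear.

Lemma to_dualD x y : to_dual (x + y) = to_dual x + to_dual y.
Proof. exact: linearD. Qed.

Lemma to_dualN x : to_dual (- x) = - to_dual x.
Proof. exact: linearN. Qed.

Lemma to_dualZ k x : to_dual (k *: x) = k *: to_dual x.
Proof. exact: linearZ. Qed.

Lemma to_dual_even b x : homog b x -> homog b (to_dual x).
Proof.
move=> hx; apply/homog_lag_dualP => v hv; rewrite to_dualE.
apply: (spl_parity H hx (spl_s H hv)).
by case: b {hx hv}; case: eps.
Qed.

(** The section is isotropic, so that the map to the dual only sees the
    component in the ideal. *)
Lemma to_dual_s u : to_dual (s u) = 0.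
Proof.
rewrite -[LHS]lag_evK -[RHS]lag_evK linear0; congr lag_of; apply/lfunP => v.
by rewrite to_dualE (spl_section_isotropic H); apply/esym; exact: lfunE.
Qed.

Lemma to_dual_vert x : to_dual (vert x) = to_dual x.
Proof. by rewrite linearB /= to_dual_s subr0. Qed.

Definition split_fun (x : g) : dsum V (lag_dual eps V) := (p x, to_dual x).

Lemma split_fun_linear : linear split_fun.
Proof. by move=> k x y; rewrite /split_fun !linearP. Qed.
HB.instance Definition _ := GRing.isLinear.Build R g (dsum V (lag_dual eps V))
  *:%R split_fun split_fun_linear.

Definition split_hom : 'Hom(g, dsum V (lag_dual eps V)) := linfun split_fun.

Lemma split_homE x : split_hom x = (p x, to_dual x).
Proof. by rewrite lfunE. Qed.

Lemma split_hom_inj : lker split_hom == 0%VS.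
Proof.
apply/lker0P => x y; rewrite !lfunE /= => -[pxy qxy].
apply/eqP; rewrite -subr_eq0; apply/eqP; apply: (spl_nondeg H) => z.
have pk : p (x - y) = 0 by rewrite linearB /= pxy subrr.
rewrite (vertE z) form_Dr (spl_ideal_isotropic H pk (p_vert z)) addr0.
by rewrite form_Dl form_Nl -!to_dualE qxy subrr.
Qed.

(** The only use of the dimension: an injective map between spaces of the same
    dimension. *)
Lemma split_hom_surj : limg split_hom = fullv.
Proof.
apply/eqP; rewrite eqEdim subvf limg_dim_eq; last first.
  by rewrite (eqP split_hom_inj) capv0.
rewrite (spl_dim H) -{2}(dim_lag_dual eps V) !dimvf; exact: leqnn.
Qed.

Definition of_dual (xi : 'Hom(V, R^o)) : g := (split_hom^-1)%VF (0, lag_of eps xi).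

Lemma split_homK x : split_hom ((split_hom^-1)%VF x) = x.
Proof. by apply: limg_lfunVK; rewrite split_hom_surj memvf. Qed.

Lemma split_hom_bij : bijective split_hom.
Proof.
exists (split_hom^-1)%VF; last exact: split_homK.
exact: lker0_lfunK split_hom_inj.
Qed.

Lemma of_dualE xi : p (of_dual xi) = 0 /\ to_dual (of_dual xi) = lag_of eps xi.
Proof. by have := split_homK (0, lag_of eps xi); rewrite lfunE /= => -[]. Qed.

Lemma of_dual_linear : linear of_dual.
Proof.
move=> k x y; rewrite /of_dual -linearP; congr (_ _).
by congr pair => /=; rewrite ?scaler0 ?addr0 // linearP.
Qed.
HB.instance Definition _ := GRing.isLinear.Build R 'Hom(V, R^o) g *:%R
  of_dual of_dual_linear.

Lemma of_dualK n : p n = 0 -> of_dual (lag_ev (to_dual n)) = n.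
Proof.
move=> pn; have [p0 q0] := of_dualE (lag_ev (to_dual n)).
apply: (bij_inj split_hom_bij); by rewrite !split_homE p0 q0 lag_evK pn.
Qed.

(** * The connection dual to the action on the ideal *)

Definition conn (u v : V) : V :=
  bidual_vec (fun xi => w (br (of_dual xi) (s u)) (s v)).

(** This identity, read as the transpose of the right action of s(u) on the
    ideal, determines nabla. *)
Lemma conn_adj n u v : p n = 0 -> w n (s (conn u v)) = w (br n (s u)) (s v).
Proof.
move=> pn; rewrite -to_dualE /conn bidual_vecE ?of_dualK // => k x y.
by rewrite linearP /= brDl brZl form_Dl linearZ scale_lfunE.
Qed.

Fact conn_linear_r u : linear (conn u).
Proof.
move=> k x y; rewrite /conn /bidual_vec scaler_sumr -big_split /=.
by apply: eq_bigr => i _; rewrite !linearP /= scalerDl scalerA.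
Qed.
HB.instance Definition _ u := GRing.isLinear.Build R V V *:%R (conn u)
  (conn_linear_r u).

Definition conn_end u : 'End(V) := linfun (conn u).

Fact conn_linear_l : linear conn_end.
Proof.
move=> k x y; rewrite /conn_end; apply/lfunP => v; rewrite add_lfunE scale_lfunE !lfunE /=.
rewrite /conn /bidual_vec scaler_sumr -big_split /=.
apply: eq_bigr => i _; rewrite linearP brDr brZr form_Dl linearZ scale_lfunE /=.
by rewrite scalerDl scalerA.
Qed.
HB.instance Definition _ := GRing.isLinear.Build R V 'End(V) *:%R
  conn_end conn_linear_l.

Definition conn_hom : 'Hom(V, 'End(V)) := linfun conn_end.

Lemma conn_homE u v : conn_hom u v = conn u v.
Proof. by rewrite /conn_hom lfunE /= /conn_end lfunE. Qed.

Lemma section_sep_homog u :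
  (forall b n, homog b n -> p n = 0 -> w n (s u) = 0) -> u = 0.
Proof.
move=> wu; apply: section_sep; apply: ker_ind => // x y hx hy.
by rewrite form_Dl hx hy addr0.
Qed.

Lemma form_sec_proj n x : p n = 0 -> w n (s (p x)) = w n x.
Proof. by move=> pn; rewrite [in RHS](vertE x) form_Dr (spl_ideal_isotropic H pn (p_vert x)) addr0. Qed.

Lemma form_secB n u v : w n (s (u - v)) = w n (s u) - w n (s v).
Proof. by rewrite linearB; exact: linearB. Qed.

Lemma form_secZ n k u : w n (s (k *: u)) = k * w n (s u).
Proof. by rewrite linearZ; exact: linearZ. Qed.

(** The component of nabla_u v of the wrong parity pairs with homogeneous n in
    the ideal only when |n| is such that both w(n, s(nabla_u v)) and the pairing
    of n with the other component vanish. *)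
Fact conn_even a b u v : homog a u -> homog b v ->
  homog (a (+) b) (conn_hom u v).
Proof.
move=> hu hv; rewrite conn_homE.
suff e : pr V (~~ (a (+) b)) (conn u v) = 0.
  rewrite /homog -{2}(pr_sum (conn u v)).
  by case: (a (+) b) e => /= ->; rewrite ?addr0 ?add0r.
apply: section_sep_homog => c n hn pn.
have [ne|/eqP/negPn ne] := boolP (c (+) ~~ (a (+) b) != eps).
  exact: (spl_parity H hn (spl_s H (homog_pr _ _)) ne).
have w0 : w n (s (conn u v)) = 0.
  rewrite conn_adj //.
  apply: (spl_parity H (br_even hn (spl_s H hu)) (spl_s H hv)).
  by move: ne; case: a {hu}; case: b {hv}; case: c {hn}; case: eps.
rewrite -w0 -[in RHS](pr_sum (conn u v)) linearD /= form_Dr.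
have w1 : w n (s (pr V (a (+) b) (conn u v))) = 0.
  apply: (spl_parity H hn (spl_s H (homog_pr _ _))).
  by move: ne; case: a {hu}; case: b {hv}; case: c {hn}; case: eps.
by case: (a (+) b) w1 => /= ->; rewrite ?addr0 ?add0r.
Qed.

(** Torsion-freeness is closedness of the form on one argument in the ideal and
    two in the section. *)
Fact conn_torsion a b u v : homog a u -> homog b v ->
  conn_hom u v - (-1) ^+ (a && b) *: conn_hom v u = quot_br u v.
Proof.
move=> hu hv; apply/eqP; rewrite -subr_eq0; apply/eqP.
apply: section_sep_homog => c n hn pn.
have hsu := spl_s H hu; have hsv := spl_s H hv.
rewrite !conn_homE !form_secB form_secZ.
rewrite !conn_adj // form_sec_proj //.
have := spl_closed H hn hsu hsv.
rewrite (spl_anti H hsv (br_even hn hsu)) (br_anti hsv hn).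
rewrite form_Nr form_Zr (spl_anti H hsu (br_even hn hsv)).
by case: a {hu hsu}; case: b {hv hsv}; case: c {hn};
  rewrite /= ?expr0 ?expr1 => e; lra.
Qed.

(** Flatness is the Jacobi identity on one argument in the ideal and two in the
    section, the ideal being abelian. *)
Fact conn_flat a b c x y z : homog a x -> homog b y -> homog c z ->
  conn_hom x (conn_hom y z) - (-1) ^+ (a && b) *: conn_hom y (conn_hom x z) =
    conn_hom (quot_br x y) z.
Proof.
move=> hx hy _; apply/eqP; rewrite -subr_eq0; apply/eqP.
apply: section_sep_homog => d n hn pn.
have hsx := spl_s H hx; have hsy := spl_s H hy.
rewrite !conn_homE !form_secB form_secZ.
rewrite !conn_adj //; try exact: ideal_l.
have -> : br n (s (quot_br x y)) = br n (br (s x) (s y)).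
  rewrite [in RHS](vertE (br (s x) (s y))) brDr.
  by rewrite (ker_abelian pn (p_vert _)) addr0.
rewrite (br_jacobi hn hsx hsy) (br_anti hsx (br_even hn hsy)).
rewrite form_Dl form_Zl form_Nl form_Zl.
by case: a {hx hsx}; case: b {hy hsy}; case: d {hn};
  rewrite /= ?expr0 ?expr1; ring.
Qed.

Definition split_connection : flat_connection quot :=
  @FlatConnection R quot conn_hom conn_even conn_torsion conn_flat.

Lemma split_rep u n : p n = 0 ->
  lag_rep eps split_connection u (to_dual n) = to_dual (br (s u) n).
Proof.
have rD x y m : lag_rep eps split_connection (x + y) m =
    lag_rep eps split_connection x m + lag_rep eps split_connection y m.
  by have := act_linear_l (lag_rep eps split_connection) m 1 x y; rewrite !scale1r.
have rDr x m m' : lag_rep eps split_connection x (m + m') =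
    lag_rep eps split_connection x m + lag_rep eps split_connection x m'.
  by have := act_linear_r (lag_rep eps split_connection) x 1 m m'; rewrite !scale1r.
move: n; apply: ker_ind => [m n hm hn|b n hn pn].
  by rewrite linearD rDr hm hn brDr linearD.
move: u; apply: homog_ind => [x y hx hy|a u hu].
  by rewrite rD hx hy linearD brDl linearD.
rewrite -[LHS]lag_evK -[RHS]lag_evK; congr lag_of; apply/lfunP => v.
rewrite (lag_ev_rep split_connection v hu (to_dual_even hn)) !to_dualE.
rewrite conn_homE conn_adj // (br_anti (spl_s H hu) hn).
by rewrite form_Nl form_Zl.
Qed.

(** * The cocycle and the isomorphism *)

Definition split_cval (u v : V) : lag_dual eps V := to_dual (br (s u) (s v)).

Fact split_cval_linear_r u : linear (split_cval u).
Proof. by move=> k x y; rewrite /split_cval linearP brDr brZr linearP. Qed.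
HB.instance Definition _ u := GRing.isLinear.Build R V (lag_dual eps V) *:%R
  (split_cval u) (split_cval_linear_r u).

Definition split_cval_hom u : 'Hom(V, lag_dual eps V) := linfun (split_cval u).

Fact split_cval_linear_l : linear split_cval_hom.
Proof.
move=> k x y; rewrite /split_cval_hom; apply/lfunP => v; rewrite add_lfunE scale_lfunE !lfunE /=.
by rewrite /split_cval linearP brDl brZl linearP.
Qed.
HB.instance Definition _ := GRing.isLinear.Build R V 'Hom(V, lag_dual eps V)
  *:%R split_cval_hom split_cval_linear_l.

Definition split_chom : 'Hom(V, 'Hom(V, lag_dual eps V)) :=
  linfun split_cval_hom.

Lemma split_chomE u v : split_chom u v = to_dual (br (s u) (s v)).
Proof. by rewrite /split_chom lfunE /= /split_cval_hom lfunE. Qed.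

Fact split_even a b u v : homog a u -> homog b v ->
  homog (a (+) b) (split_chom u v).
Proof.
move=> hu hv; rewrite split_chomE; apply: to_dual_even.
by apply: br_even; apply: (spl_s H).
Qed.

Fact split_anti a b u v : homog a u -> homog b v ->
  split_chom u v = - ((-1) ^+ (a && b) *: split_chom v u).
Proof.
move=> hu hv; rewrite !split_chomE (br_anti (spl_s H hu) (spl_s H hv)).
by rewrite linearN linearZ.
Qed.

Lemma split_rep_cval u v z : lag_rep eps split_connection u (split_chom v z) =
  to_dual (br (s u) (br (s v) (s z))) - split_chom u (quot_br v z).
Proof.
rewrite !split_chomE -(to_dual_vert (br (s v) (s z))).
by rewrite split_rep ?p_vert // brDr brNr linearB.
Qed.

(** The component in the ideal of the Jacobi identity on the section. *)
Fact split_cocycle a b c u v z : homog a u -> homog b v -> homog c z ->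
  lag_rep eps split_connection u (split_chom v z)
    - (-1) ^+ (a && b) *: lag_rep eps split_connection v (split_chom u z)
    + (-1) ^+ ((a (+) b) && c) *: lag_rep eps split_connection z (split_chom u v)
    - split_chom (quot_br u v) z + (-1) ^+ (b && c) *: split_chom (quot_br u z) v
    + split_chom u (quot_br v z) = 0.
Proof.
move=> hu hv hz; rewrite !split_rep_cval.
have hsu := spl_s H hu; have hsv := spl_s H hv; have hsz := spl_s H hz.
rewrite (br_jacobi hsu hsv hsz) (br_anti hsz (br_even hsu hsv)).
rewrite (split_anti hz (quot_even hu hv)) (split_anti hv (quot_even hu hz)).
rewrite !(to_dualD, to_dualN, to_dualZ).
case: a {hu hsu}; case: b {hv hsv}; case: c {hz hsz};
  rewrite /= ?expr0 ?expr1 ?scale1r ?scaleN1r ?opprK;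
  apply: additive_eq => f f0 fD fN; rewrite !(f0, fD, fN); lra.
Qed.

Definition split_cocycle2 : cocycle2 (lag_rep eps split_connection) :=
  @Cocycle2 R quot (lag_dual eps V) (lag_rep eps split_connection) split_chom
    split_even split_anti split_cocycle.

Lemma vert_homog b x : homog b x -> homog b (vert x).
Proof. by move=> hx; apply/homogD/homogN/(spl_s H)/(spl_p H). Qed.

Lemma split_hom_br x y :
  split_hom (br x y) = br (split_hom x : abelian_ext split_cocycle2) (split_hom y).
Proof.
have fD u v : split_hom (u + v) = split_hom u + split_hom v.
  exact: linearD.
move: x y; apply: homog_ind => [x x' hx hx' y|a x hx].
  by rewrite brDl !fD hx hx'; apply/esym/(@brDl R (abelian_ext split_cocycle2)).
apply: homog_ind => [y y' hy hy'|b y hy].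
  by rewrite brDr !fD hy hy'; apply/esym/(@brDr R (abelian_ext split_cocycle2)).
rewrite !split_homE /= /ext_br /=; congr pair.
  by rewrite /quot_br p_br_sp p_br_spl.
rewrite (@ract_homog R quot _ (lag_rep eps split_connection) _ _ _ _
  (to_dual_even hx) (spl_p H hy)).
rewrite -[to_dual x]to_dual_vert -[to_dual y]to_dual_vert.
rewrite !split_rep ?p_vert // split_chomE.
have -> : br x y = br (s (p x) + vert x) (s (p y) + vert y) by rewrite -!vertE.
rewrite (brDl (s (p x)) (vert x)) (brDr (s (p x)) (s (p y)))
  (brDr (vert x) (s (p y))).
rewrite (ker_abelian (p_vert x) (p_vert y)) addr0.
rewrite (br_anti (vert_homog hx) (spl_s H (spl_p H hy))) andbC.
by rewrite !(to_dualD, to_dualN, to_dualZ).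
Qed.

Theorem lagrangian_splittingP : is_lagrangian_extension eps g quot.
Proof.
exists split_connection, split_cocycle2; split.
  move=> i j k u v z hu hv hz.
  have hsu := spl_s H hu; have hsv := spl_s H hv; have hsz := spl_s H hz.
  rewrite /= !split_chomE !to_dualE.
  have := spl_closed H hsu hsv hsz.
  rewrite (spl_anti H hsu (br_even hsv hsz)) (spl_anti H hsv (br_even hsz hsu)).
  rewrite (spl_anti H hsz (br_even hsu hsv)).
  by case: i {hu hsu}; case: j {hv hsv}; case: k {hz hsz};
    rewrite /= ?expr0 ?expr1 => e; lra.
exists split_hom; split; [exact: split_hom_bij| |exact: split_hom_br].
move=> b x hx; rewrite split_homE.
by congr pair; [exact: (spl_p H hx)|exact: to_dual_even hx].
Qed.

End Splitting.

(** * The canonical form of a Lagrangian extension *)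

Section CanonicalForm.
Variables (R : realType) (eps : bool) (h : lieSuperalg R).
Variables (D : flat_connection h) (c : cocycle2 (lag_rep eps D)).
Let G := abelian_ext c.

(** The canonical form involves the sign (-1)^(|m||u|), which only matters when
    |m| = |u| + eps: it is then 1 for eps = true and (-1)^|u| for eps = false. *)
Definition twist (u : h) : h := pr h false u + (-1) ^+ (~~ eps) *: pr h true u.

Fact twist_linear : linear twist.
Proof.
move=> k x y; rewrite /twist (linearP (pr h false)) (linearP (pr h true)) !scalerDr !scalerA.
by rewrite (mulrC k) addrACA.
Qed.
HB.instance Definition _ := GRing.isLinear.Build R h h *:%R twist twist_linear.

Lemma twistD u v : twist (u + v) = twist u + twist v.
Proof. exact: linearD. Qed.

Lemma twistZ k u : twist (k *: u) = k *: twist u.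
Proof. exact: linearZ. Qed.

Lemma twist_homog a u : homog a u -> twist u = (-1) ^+ (a && ~~ eps) *: u.
Proof.
move=> hu; rewrite /twist !(homog_prE _ hu).
by case: a {hu}; case: eps; rewrite /= ?scaler0 ?scale1r ?addr0 ?add0r.
Qed.

Lemma twistK : involutive twist.
Proof.
apply: homog_ind => [x y hx hy|a x hx]; first by rewrite (twistD x) (twistD (twist x)) hx hy.
rewrite (twist_homog hx) (twistZ _ x) (twist_homog hx) scalerA.
by rewrite -signr_addb addbb scale1r.
Qed.

Definition canon_val (x y : G) : R^o :=
  lag_ev x.2 y.1 - lag_ev y.2 (twist x.1).

Fact canon_linear_r x : linear (canon_val x).
Proof.
move=> k y z; rewrite /canon_val lag_evDr lag_evZr lag_evD lag_evZ.
by rewrite opprD addrACA -mulrBr.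
Qed.
HB.instance Definition _ x := GRing.isLinear.Build R G R^o *:%R (canon_val x)
  (canon_linear_r x).

Definition canon_hom (x : G) : 'Hom(G, R^o) := linfun (canon_val x).

Fact canon_hom_linear : linear canon_hom.
Proof.
move=> k x y; rewrite /canon_hom; apply/lfunP => z.
rewrite add_lfunE scale_lfunE !lfunE /= /canon_val lag_evD lag_evZ.
by rewrite twistD twistZ lag_evDr lag_evZr opprD addrACA -mulrBr.
Qed.
HB.instance Definition _ := GRing.isLinear.Build R G 'Hom(G, R^o) *:%R
  canon_hom canon_hom_linear.

Definition canon_form : 'Hom(G, 'Hom(G, R^o)) := linfun canon_hom.

Lemma canon_formE x y :
  canon_form x y = lag_ev x.2 y.1 - lag_ev y.2 (twist x.1).
Proof. by rewrite /canon_form lfunE /= /canon_hom lfunE. Qed.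

Lemma homog_ext b (x : G) : homog b x -> homog b x.1 /\ homog b x.2.
Proof. by case: x => u m [hu hm]. Qed.

Lemma canon_formE_homog a b x y : homog a x -> homog b y ->
  canon_form x y = lag_ev x.2 y.1 - (-1) ^+ (a && b) * lag_ev y.2 x.1.
Proof.
move=> /homog_ext[x1 _] /homog_ext[_ y2]; rewrite canon_formE (twist_homog x1).
rewrite lag_evZr; congr (_ - _).
have [ab|ab] := eqVneq (b (+) a) eps.
  by congr (_ * _); rewrite -ab; case: a {x1 ab}; case: b {y2}.
by rewrite (lag_ev_parity y2 x1 ab) !mulr0.
Qed.

Lemma canon_form_parity : parity_form eps canon_form.
Proof.
move=> a b x y hx hy ab; rewrite (canon_formE_homog hx hy).
have [x1 x2] := homog_ext hx; have [y1 y2] := homog_ext hy.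
rewrite (lag_ev_parity x2 y1 ab) (lag_ev_parity y2 x1) ?mulr0 ?subr0 //.
by rewrite addbC.
Qed.

Lemma canon_form_anti : antisymmetric_form canon_form.
Proof.
move=> a b x y hx hy.
rewrite (canon_formE_homog hx hy) (canon_formE_homog hy hx).
by case: a {hx}; case: b {hy}; rewrite /= ?expr0 ?expr1; ring.
Qed.

Lemma canon_form_nondeg : nondegenerate_form canon_form.
Proof.
move=> x wx.
have x2 : x.2 = 0.
  rewrite -[x.2]lag_evK -[RHS]lag_evK; congr lag_of; apply/lfunP => v.
  have := wx (v, 0); rewrite canon_formE /= linear0 zero_lfunE subr0 => ->.
  by rewrite zero_lfunE.
have x1 : x.1 = 0.
  apply: (inv_inj twistK); rewrite [RHS]linear0.
  rewrite (coord_vbasis (memvf (twist x.1))) big1 // => k _.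
  set xi := linfun (coord (vbasis {: h}) k : h -> R^o).
  have := wx (0, lag_of eps xi).
  rewrite canon_formE /= lag_ofK lfunE /= linear0 sub0r => /eqP.
  by rewrite oppr_eq0 => /eqP ->; rewrite scale0r.
by case: x x1 x2 {wx} => u m /= -> ->.
Qed.

(** Each term in which two arguments are in h and one in the ideal cancels by
    torsion-freeness; the terms with three arguments in h are the cyclic
    condition. *)
Lemma canon_form_closed : lag_cyclic c -> closed_form canon_form.
Proof.
move=> cyc i j k x y z hx hy hz.
have [x1 x2] := homog_ext hx; have [y1 y2] := homog_ext hy.
have [z1 z2] := homog_ext hz.
rewrite (canon_formE_homog hx (br_even hy hz)).
rewrite (canon_formE_homog hz (br_even hx hy)).
rewrite (canon_formE_homog hy (br_even hz hx)) /=.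
rewrite (ract_homog _ y2 z1) (ract_homog _ x2 y1) (ract_homog _ z2 x1).
rewrite !(lag_evD, lag_evN, lag_evZ).
rewrite (lag_ev_rep D _ y1 z2) (lag_ev_rep D _ z1 y2) (lag_ev_rep D _ x1 y2).
rewrite (lag_ev_rep D _ y1 x2) (lag_ev_rep D _ z1 x2) (lag_ev_rep D _ x1 z2).
have torsion a b u v (m : lag_dual eps h) : homog a u -> homog b v ->
    lag_ev m (br u v) = lag_ev m (D u v) - (-1) ^+ (a && b) * lag_ev m (D v u).
  by move=> hu hv; rewrite -(nabla_torsion_free D hu hv) linearB linearZ.
rewrite (torsion _ _ _ _ _ y1 z1) (torsion _ _ _ _ _ x1 y1).
rewrite (torsion _ _ _ _ _ z1 x1).
have := cyc _ _ _ _ _ _ x1 y1 z1.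
by case: i {hx x1 x2}; case: j {hy y1 y2}; case: k {hz z1 z2};
  rewrite /= ?expr0 ?expr1 => e; lra.
Qed.

(** For an even pairing, h and its dual have the same odd dimension. *)
Lemma odd_vector_in_dual (y : G) : eps = false -> homog true y -> y != 0 ->
  exists m : lag_dual eps h, homog true m /\ m != 0.
Proof.
move=> e0 /homog_ext[y1 y2] ny.
have [y20|] := eqVneq y.2 0; last by exists y.2.
have ny1 : y.1 != 0.
  by apply: contraNneq ny => y10; case: y y10 y20 {y1 y2} => u m /= -> ->.
have [k hk] : exists k, coord (vbasis {: h}) k y.1 != 0.
  apply/existsP; apply: contraNT ny1; rewrite negb_exists => /forallP z0.
  rewrite (coord_vbasis (memvf y.1)) big1 // => k _.
  by have := z0 k; rewrite negbK => /eqP ->; rewrite scale0r.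
set xi := linfun (coord (vbasis {: h}) k : h -> R^o).
exists (pr (lag_dual eps h) true (lag_of eps xi)); split.
  exact: homog_pr.
apply: contraNneq hk => p0.
have : lag_ev (lag_of eps xi) y.1 = 0.
  rewrite -(pr_sum (lag_of eps xi)) p0 addr0.
  by apply: (lag_ev_parity (homog_pr _ _) y1); rewrite e0.
by rewrite lag_ofK lfunE /= => ->.
Qed.

Lemma ext_ideal_isotropic (m : lag_dual eps h) :
  br ((0, m) : G) ((0, m) : G) = 0 /\ canon_form (0, m) (0, m) = 0.
Proof.
split; last by rewrite canon_formE /= (linear0 twist) subrr.
have r0 n : lag_rep eps D 0 n = 0.
  exact: (linear_zero (act_linear_l (lag_rep eps D) n)).
rewrite /= /ext_br /= br0r linear0 r0 /ract big1 ?subr0 ?addr0 // => a _.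
by rewrite big1 // => b _; rewrite linear0 r0 scaler0.
Qed.

End CanonicalForm.

Section Pullback.
Variables (R : realType) (g G : lieSuperalg R) (f : 'Hom(g, G)).
Variable w : 'Hom(G, 'Hom(G, R^o)).

Definition pull_hom (x : g) : 'Hom(g, R^o) := (w (f x) \o f)%VF.

Fact pull_hom_linear : linear pull_hom.
Proof.
by move=> k x y; rewrite /pull_hom 2!linearP comp_lfunDl -comp_lfunZl.
Qed.
HB.instance Definition _ := GRing.isLinear.Build R g 'Hom(g, R^o) *:%R
  pull_hom pull_hom_linear.

Definition pull_form : 'Hom(g, 'Hom(g, R^o)) := linfun pull_hom.

Lemma pull_formE x y : pull_form x y = w (f x) (f y).
Proof. by rewrite /pull_form lfunE /= comp_lfunE. Qed.

End Pullback.

(** A partial converse of lagrangian_splittingP, whose conclusions are the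
    obstructions used against the exceptional algebras. *)
Lemma lagrangian_extension_form (R : realType) eps (g h : lieSuperalg R) :
  is_lagrangian_extension eps g h ->
  exists w : 'Hom(g, 'Hom(g, R^o)),
    [/\ antisymmetric_form w, closed_form w, nondegenerate_form w &
        parity_form eps w] /\
    forall y : g, eps = false -> homog true y -> y != 0 ->
      exists x : g, [/\ homog true x, x != 0, br x x = 0 & w x x = 0].
Proof.
move=> [D [c [cyc [f [[f' fK f'K] fe fm]]]]].
have f_inj := can_inj fK.
pose w := pull_form f (canon_form c); exists w.
split; first split.
- by move=> a b x y hx hy; rewrite !pull_formE; apply: canon_form_anti; exact: fe.
- move=> i j k x y z hx hy hz; rewrite !pull_formE !fm.
  by apply: (canon_form_closed cyc); exact: fe.
- move=> x wx; apply: f_inj; rewrite linear0; apply: (@canon_form_nondeg _ _ _ _ c).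
  by move=> y; rewrite -(f'K y) -pull_formE.
- by move=> a b x y hx hy; rewrite pull_formE; apply: canon_form_parity; exact: fe.
move=> y e0 hy ny.
have [|m [hm nm]] := @odd_vector_in_dual _ _ _ _ c (f y) e0 (fe _ _ hy).
  by rewrite -(inj_eq f_inj) linear0 in ny.
have [brm wm] := ext_ideal_isotropic c m.
exists (f' (0, m)); split.
- apply: f_inj; rewrite (even_pr fe) f'K.
  by congr pair; [rewrite linear0|exact: hm].
- by apply: contraNneq nm => f0; have := f'K (0, m); rewrite f0 linear0 => -[<-].
- by apply: f_inj; rewrite fm f'K brm linear0.
- by rewrite pull_formE f'K.
Qed.

(** * Forms on algebras given by structure constants *)

Definition odd_index (i : 'I_4) : bool := (1 < i)%N.

Section TableForm.
Variable R : realType.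
Local Notation e := (delta_mx 0 : 'I_4 -> r22 R).

Lemma table_br_coord c (x y : r22 R) k : table_br c x y 0 k =
  \sum_(i < 4) \sum_(j < 4) x 0 i * y 0 j * sconst c i.+1 j.+1 k.+1.
Proof.
rewrite /table_br summxE; apply: eq_bigr => i _; rewrite summxE.
by apply: eq_bigr => j _; rewrite !mxE.
Qed.

Lemma homog_e i : homog (odd_index i) (e i).
Proof.
apply/rowP => j; rewrite !mxE /=.
by have [->|_] := eqVneq j i; rewrite ?eqxx //; case: ifP.
Qed.

Lemma homog_coord0 b (x : r22 R) i : homog b x -> odd_index i != b -> x 0 i = 0.
Proof. by move=> <- hb; rewrite mxE (negbTE hb). Qed.

Lemma homog_basis_ind (P : bool -> r22 R -> Prop) :
  (forall b k x y, P b x -> P b y -> P b (k *: x + y)) ->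
  (forall b, P b 0) -> (forall i, P (odd_index i) (e i)) ->
  forall b x, homog b x -> P b x.
Proof.
move=> PD P0 Pe b x hx; rewrite (row_sum_delta x); apply: big_ind => //.
  by move=> y z hy hz; rewrite -[y]scale1r; exact: PD.
move=> i _; have [<-|ib] := eqVneq (odd_index i) b.
  by rewrite -[_ *: _]addr0; exact: PD.
by rewrite (homog_coord0 hx ib) scale0r.
Qed.

Implicit Type f : nat -> nat -> R.

(** As for the structure constants, only the values with i <= j are read; the
    other ones follow from super anti-symmetry. *)
Definition fconst f (i j : nat) : R :=
  if (i <= j)%N then f i j
  else if (2 < i)%N && (2 < j)%N then f j i else - f j i.

Definition form_val f (x y : r22 R) : R^o :=
  \sum_(i < 4) \sum_(j < 4) x 0 i * y 0 j * fconst f i.+1 j.+1.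

Fact form_val_linear_r f x : linear (form_val f x).
Proof.
move=> k y z; rewrite /form_val scaler_sumr -big_split; apply: eq_bigr => i _.
rewrite scaler_sumr -big_split; apply: eq_bigr => j _.
by rewrite !mxE /GRing.scale /=; ring.
Qed.
HB.instance Definition _ f x := GRing.isLinear.Build R (r22 R) R^o *:%R
  (form_val f x) (form_val_linear_r f x).

Definition form_hom f (x : r22 R) : 'Hom(r22 R, R^o) := linfun (form_val f x).

Fact form_hom_linear f : linear (form_hom f).
Proof.
move=> k x y; rewrite /form_hom; apply/lfunP => z.
rewrite add_lfunE scale_lfunE !lfunE /= /form_val scaler_sumr -big_split.
apply: eq_bigr => i _; rewrite scaler_sumr -big_split; apply: eq_bigr => j _.
by rewrite !mxE /GRing.scale /=; ring.
Qed.
HB.instance Definition _ f := GRing.isLinear.Build R (r22 R)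
  'Hom(r22 R, R^o) *:%R (form_hom f) (form_hom_linear f).

Definition table_form f : 'Hom(r22 R, 'Hom(r22 R, R^o)) := linfun (form_hom f).

Lemma table_formE f x y : table_form f x y =
  \sum_(i < 4) \sum_(j < 4) x 0 i * y 0 j * fconst f i.+1 j.+1.
Proof. by rewrite /table_form lfunE /= /form_hom lfunE. Qed.

Lemma table_form_e f i j : table_form f (e i) (e j) = fconst f i.+1 j.+1.
Proof.
rewrite table_formE (bigD1 i) //= (bigD1 j) //= !mxE !eqxx !mul1r.
rewrite !big1 ?addr0 // => [k /negbTE ki|k /negbTE kj].
  by rewrite big1 // => l _; rewrite !mxE ki andbF !mul0r.
by rewrite !mxE kj andbF mulr0 mul0r.
Qed.

Lemma table_form_er f i (x : r22 R) :
  table_form f (e i) x = \sum_(m < 4) x 0 m * fconst f i.+1 m.+1.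
Proof.
rewrite {1}(row_sum_delta x) linear_sum; apply: eq_bigr => m _.
by rewrite linearZ; congr (_ * _); exact: table_form_e.
Qed.

Lemma table_br_e c i j k :
  table_br c (e i) (e j) 0 k = sconst c i.+1 j.+1 k.+1.
Proof.
rewrite table_br_coord (bigD1 i) //= (bigD1 j) //= !mxE !eqxx !mul1r.
rewrite !big1 ?addr0 // => [m /negbTE mi|m /negbTE mj].
  by rewrite big1 // => l _; rewrite !mxE mi andbF !mul0r.
by rewrite !mxE mj andbF mulr0 mul0r.
Qed.

Section Conditions.
Variables (c : nat -> nat -> nat -> R) (ec : table_even c) (dc : table_diag c).
Variables (jc : table_jacobi c) (f : nat -> nat -> R) (eps : bool).
Let g := table_alg ec dc jc.
Let w : 'Hom(g, 'Hom(g, R^o)) := table_form f.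

Definition table_parity : Prop := forall i j : 'I_4, (i <= j)%N ->
  odd_index i (+) odd_index j != eps -> f i.+1 j.+1 = 0.

Definition table_alternating : Prop := forall i : 'I_4,
  ~~ odd_index i -> f i.+1 i.+1 = 0.

Definition sum4 (u : nat -> R) : R := u 0%N + u 1%N + u 2%N + u 3%N.

Definition table_closed : Prop := forall i j k : 'I_4,
  (i <= j)%N -> (j <= k)%N ->
  odd_index i (+) odd_index j (+) odd_index k == eps ->
  let sg a b : R := if odd_index a && odd_index b then -1 else 1 in
  let u (a b d : 'I_4) := sum4 (fun m =>
    sconst c b.+1 d.+1 m.+1 * fconst f a.+1 m.+1) in
  sg i k * u i j k + sg k j * u k i j + sg j i * u j k i = 0.

Definition table_nondegenerate : Prop := forall x : nat -> R,
  (forall j : 'I_4, sum4 (fun m => x m * fconst f m.+1 j.+1) = 0) ->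
  forall i : 'I_4, x i = 0.

Lemma table_form_parity : table_parity -> parity_form eps w.
Proof.
move=> pf a b x y hx hy ab; rewrite /w table_formE big1 // => i _.
rewrite big1 // => j _.
have [ia|ia] := eqVneq (odd_index i) a; last first.
  by rewrite (homog_coord0 hx ia) !mul0r.
have [jb|jb] := eqVneq (odd_index j) b; last first.
  by rewrite (homog_coord0 hy jb) mulr0 mul0r.
rewrite /fconst !ltnS; case: (leqP i j) => [ij|/ltnW ji].
  by rewrite (pf _ _ ij) ?mulr0 ?ia ?jb.
by rewrite (pf _ _ ji) ?oppr0 ?if_same ?mulr0 // ia jb addbC.
Qed.

Lemma table_form_anti : table_alternating -> antisymmetric_form w.
Proof.
move=> df; have anti i j : w (e i) (e j) =
    - ((-1) ^+ (odd_index i && odd_index j) * w (e j) (e i)).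
  rewrite /w !table_form_e /fconst !ltnS andbC /odd_index.
  case: (ltngtP i j) => [ij|ij|/val_inj<-].
  - by case: ((1 < j)%N && (1 < i)%N); rewrite ?mulN1r ?mul1r opprK.
  - by case: ((1 < j)%N && (1 < i)%N); rewrite ?mulN1r ?mul1r ?opprK.
  - rewrite andbb; case: (boolP (1 < i)%N) => i2; first by rewrite mulN1r opprK.
    by rewrite df // mulr0 oppr0.
move=> a b x y hx hy; move: y hy.
apply: (homog_basis_ind (P := fun b y => w x y = - ((-1) ^+ (a && b) * w y x))).
- move=> {}b k y z hy hz; rewrite form_Dr form_Zr form_Dl form_Zl hy hz; ring.
- by move=> {}b; rewrite !linear0 zero_lfunE mulr0 oppr0.
move=> j; move: x hx.
apply: (homog_basis_ind (P := fun a x => w x (e j) =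
  - ((-1) ^+ (a && odd_index j) * w (e j) x))) => //.
- move=> {}a k y z hy hz; rewrite form_Dr form_Zr form_Dl form_Zl hy hz; ring.
- by move=> {}a; rewrite !linear0 zero_lfunE mulr0 oppr0.
Qed.

Let cyc (a b d : bool) (x y z : g) : R :=
  (-1) ^+ (a && d) * w x (br y z) + (-1) ^+ (d && b) * w z (br x y)
    + (-1) ^+ (b && a) * w y (br z x).

Let cycP1 a b d k x x' y z :
  cyc a b d (k *: x + x') y z = k * cyc a b d x y z + cyc a b d x' y z.
Proof.
by rewrite /cyc !(brDl, brZl, brDr, brZr) !(form_Dl, form_Zl, form_Dr, form_Zr); ring.
Qed.

Let cyc_rot a b d x y z : cyc a b d x y z = cyc b d a y z x.
Proof. by rewrite /cyc; ring. Qed.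

Let cyc0 a b d y z : cyc a b d 0 y z = 0.
Proof. by have := cycP1 a b d 1 0 0 y z; rewrite scaler0 addr0 => e; lra. Qed.

Let cyc_swap a b d x y z : homog a x -> homog b y -> homog d z ->
  cyc a b d x y z = 0 -> cyc b a d y x z = 0.
Proof.
rewrite /cyc => hx hy hz; rewrite (br_anti hx hz) (br_anti hy hx).
rewrite (br_anti hz hy) !(form_Nr, form_Zr).
by case: a {hx}; case: b {hy}; case: d {hz}; rewrite /= ?expr0 ?expr1 => e; lra.
Qed.

Let cyc_e (i j k : 'I_4) : R :=
  cyc (odd_index i) (odd_index j) (odd_index k) (e i) (e j) (e k).

Let w_e_br i j k : w (e i) (br (e j : g) (e k)) =
  sum4 (fun m => sconst c j.+1 k.+1 m.+1 * fconst f i.+1 m.+1).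
Proof.
rewrite /w table_form_er !big_ord_recl big_ord0 /= !table_br_e /sum4 /=.
by rewrite addr0 !addrA.
Qed.

Let cyc_e_sorted : table_parity -> table_closed -> forall i j k : 'I_4,
  (i <= j)%N -> (j <= k)%N -> cyc_e i j k = 0.
Proof.
move=> /table_form_parity pw cf i j k ij jk.
have [hp|hp] := boolP (odd_index i (+) odd_index j (+) odd_index k == eps).
  have := cf i j k ij jk hp; rewrite /= /cyc_e /cyc !w_e_br => <-.
  by case: (odd_index i); case: (odd_index j); case: (odd_index k).
have he l := homog_e l.
have hb l m : homog (odd_index l (+) odd_index m) (br (e l : g) (e m)).
  exact: (@br_even R g _ _ _ _ (he l) (he m)).
rewrite /cyc_e /cyc (pw _ _ _ _ (he i) (hb j k)); last by rewrite addbA.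
rewrite (pw _ _ _ _ (he k) (hb i j)); last by rewrite addbC.
rewrite (pw _ _ _ _ (he j) (hb k i)); last first.
  by move: hp; case: (odd_index i); case: (odd_index j); case: (odd_index k).
by rewrite !mulr0 !addr0.
Qed.

(** The cyclic sum is invariant under rotations and changes by a sign under
    transpositions, so that non-decreasing triples of basis vectors suffice; the
    triples of the wrong parity vanish with the form. *)
Lemma table_form_closed : table_parity -> table_closed -> closed_form w.
Proof.
move=> pf cf.
have s12 i j k : cyc_e i j k = 0 -> cyc_e j i k = 0.
  by apply: cyc_swap; exact: homog_e.
have s23 i j k : cyc_e i j k = 0 -> cyc_e i k j = 0.
  by rewrite /cyc_e cyc_rot => h; rewrite cyc_rot; exact: (s12 j k i).
have sorted0 := cyc_e_sorted pf cf.
have basis0 i j k : cyc_e i j k = 0.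
  case: (leqP i j) => [ij|/ltnW ji]; case: (leqP j k) => [jk|/ltnW kj];
    case: (leqP i k) => [ik|/ltnW ki].
  - exact: sorted0.
  - exact: sorted0.
  - exact/s23/sorted0.
  - exact/s23/s12/sorted0.
  - exact/s12/sorted0.
  - exact/s12/s23/sorted0.
  - exact/s12/s23/s12/sorted0.
  - exact/s12/s23/s12/sorted0.
move=> a b d x y z hx hy hz; change (cyc a b d x y z = 0).
move: x hx; apply: (homog_basis_ind (P := fun a x => cyc a b d x y z = 0)).
- by move=> {}a k x x' h h'; rewrite cycP1 h h' mulr0 addr0.
- by move=> {}a; exact: cyc0.
move=> i; rewrite cyc_rot; move: y hy.
apply: (homog_basis_ind (P := fun b y => cyc b d _ y z (e i) = 0)).
- by move=> {}b k x x' h h'; rewrite cycP1 h h' mulr0 addr0.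
- by move=> {}b; exact: cyc0.
move=> j; rewrite cyc_rot; move: z hz.
apply: (homog_basis_ind (P := fun d z => cyc d _ _ z (e i) (e j) = 0)).
- by move=> {}d k x x' h h'; rewrite cycP1 h h' mulr0 addr0.
- by move=> {}d; exact: cyc0.
by move=> k; exact: basis0.
Qed.

Lemma table_form_nondegenerate : table_nondegenerate -> nondegenerate_form w.
Proof.
move=> nf x wx; apply/rowP => i; rewrite [RHS]mxE.
have := nf (fun m => x 0 (inord m)); move=> /(_ _ i); rewrite inord_val.
apply=> j; rewrite -[RHS](wx (e j)) /w table_formE.
rewrite (eq_bigr (fun m : 'I_4 => x 0 m * fconst f m.+1 j.+1)) => [|m _].
  rewrite !big_ord_recl big_ord0 /= addr0 /sum4 !addrA.
  by do ![congr (_ + _)]; congr (_ * _); congr (x 0 _); apply: val_inj; rewrite /= inordK.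
rewrite (bigD1 j) //= big1 ?addr0 => [|l /negbTE lj].
  by rewrite !mxE !eqxx mulr1.
by rewrite !mxE lj andbF mulr0 mul0r.
Qed.

(** * Ideals spanned by two of the basis vectors *)

(** The vectors e_i0 and e_i1 span the complement, the two other ones span the
    ideal. *)

Variables i0 i1 : 'I_4.
Hypothesis i01 : i0 != i1.
Let sel (k : 'I_2) : 'I_4 := nth i0 [:: i0; i1] k.

Let sel_inj : injective sel.
Proof.
move=> k l /eqP; rewrite /sel nth_uniq ?ltn_ord //= ?inE ?andbT //.
by move/eqP/val_inj.
Qed.

Let sel_mem k : sel k \in [:: i0; i1].
Proof. by apply: mem_nth; exact: ltn_ord. Qed.

Let sub_pr (b : bool) (u : 'rV[R]_2) : 'rV[R]_2 :=
  \row_k (if odd_index (sel k) == b then u 0 k else 0).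

Let sub_pr_linear b : linear (sub_pr b).
Proof.
move=> k x y; apply/rowP => j; rewrite !mxE.
by case: eqP; rewrite ?mulr0 ?addr0.
Qed.
HB.instance Definition _ b := GRing.isLinear.Build R 'rV[R]_2 'rV[R]_2 *:%R
  (sub_pr b) (sub_pr_linear b).

Let sub_pr_pr a b x : sub_pr a (sub_pr b x) = if a == b then sub_pr b x else 0.
Proof.
apply/rowP => k; rewrite !mxE.
by case: a; case: b; rewrite /= !mxE; case: (odd_index _).
Qed.

Let sub_pr_sum x : sub_pr false x + sub_pr true x = x.
Proof.
by apply/rowP => k; rewrite !mxE; case: (odd_index _); rewrite ?addr0 ?add0r.
Qed.

Definition sub_space : superspace R :=
  @Superspace R 'rV[R]_2 (fun b => sub_pr b) sub_pr_pr sub_pr_sum.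

Let sec_fun (u : sub_space) : r22 R := \sum_k u 0 k *: e (sel k).

Let sec_linear : linear sec_fun.
Proof.
move=> k x y; rewrite /sec_fun scaler_sumr -big_split; apply: eq_bigr => l _.
by rewrite !mxE scalerDl scalerA.
Qed.
HB.instance Definition _ := GRing.isLinear.Build R sub_space (r22 R) *:%R
  sec_fun sec_linear.

Let proj_fun (x : r22 R) : sub_space := \row_k x 0 (sel k).

Let proj_linear : linear proj_fun.
Proof. by move=> k x y; apply/rowP => l; rewrite !mxE. Qed.
HB.instance Definition _ := GRing.isLinear.Build R (r22 R) sub_space *:%R
  proj_fun proj_linear.

Let s : 'Hom(sub_space, g) := linfun sec_fun.
Let p : 'Hom(g, sub_space) := linfun proj_fun.

Let sE u : s u = \sum_k u 0 k *: e (sel k).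
Proof. by rewrite lfunE. Qed.

Let pE x k : p x 0 k = x 0 (sel k).
Proof. by rewrite lfunE mxE. Qed.

Let s_coord0 u m : m \notin [:: i0; i1] -> s u 0 m = 0.
Proof.
move=> hm; rewrite sE summxE big1 // => k _; rewrite !mxE.
have [mk|] := eqVneq m (sel k); last by rewrite mulr0.
by rewrite mk sel_mem in hm.
Qed.

Let p_coord0 x m : p x = 0 -> m \in [:: i0; i1] -> x 0 m = 0.
Proof.
move=> px /(nthP i0)[k k2 <-].
by have := pE x (Ordinal k2); rewrite px mxE.
Qed.

Definition table_ideal : Prop := forall m n l : 'I_4,
  n \notin [:: i0; i1] -> l \in [:: i0; i1] -> sconst c m.+1 n.+1 l.+1 = 0.

Definition table_polarized : Prop := forall m n : 'I_4,
  (m \in [:: i0; i1]) == (n \in [:: i0; i1]) -> fconst f m.+1 n.+1 = 0.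

Lemma table_splitting : table_parity -> table_alternating -> table_closed ->
  table_nondegenerate -> table_ideal -> table_polarized ->
  lagrangian_splitting eps w s p.
Proof.
move=> pf af cf nf idl pol.
have polS (x y : g) a : (forall m, (m \in [:: i0; i1]) = a -> (x : r22 R) 0 m = 0) ->
    (forall m, (m \in [:: i0; i1]) = a -> (y : r22 R) 0 m = 0) -> w x y = 0.
  move=> x0 y0; rewrite /w table_formE big1 // => m _; rewrite big1 // => n _.
  have [ma|ma] := eqVneq (m \in [:: i0; i1]) a; first by rewrite x0 ?mul0r.
  have [na|na] := eqVneq (n \in [:: i0; i1]) a; first by rewrite y0 ?mulr0 ?mul0r.
  rewrite pol ?mulr0 //; move: ma na.
  by case: (m \in _); case: (n \in _); case: a {x0 y0}.
split.
- exact: table_form_anti.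
- exact: table_form_closed.
- exact: table_form_nondegenerate.
- exact: table_form_parity.
- move=> b u hu; rewrite sE; apply: homog_sumI => k.
  have [<-|kb] := eqVneq (odd_index (sel k)) b.
    by apply: homogZ; exact: homog_e.
  by rewrite -hu mxE (negbTE kb) scale0r /homog linear0.
- move=> b x hx; apply/rowP => k; rewrite mxE pE.
  by case: ifPn => // kb; rewrite (homog_coord0 hx kb).
- move=> u; apply/rowP => k; rewrite pE sE summxE (bigD1 k) //= big1 => [|l lk].
    by rewrite !mxE !eqxx mulr1 addr0.
  by rewrite !mxE (inj_eq sel_inj) eq_sym (negbTE lk) mulr0.
- move=> x n pn; apply/rowP => k; rewrite pE table_br_coord mxE.
  rewrite big1 // => m _; rewrite big1 // => l _.
  have [hl|hl] := boolP (l \in [:: i0; i1]).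
    by rewrite (p_coord0 pn hl) mulr0 mul0r.
  by rewrite idl ?mulr0.
- by move=> m n pm pn; apply: (polS _ _ true) => l hl; exact: p_coord0.
- by move=> u v; apply: (polS _ _ false) => l /negbT hl; exact: s_coord0.
- by rewrite !dimvf.
Qed.

Lemma table_lagrangian : table_parity -> table_alternating -> table_closed ->
  table_nondegenerate -> table_ideal -> table_polarized ->
  exists h : lieSuperalg R, \dim {: h} = 2%N /\ is_lagrangian_extension eps g h.
Proof.
move=> pf af cf nf idl pol.
have H := table_splitting pf af cf nf idl pol.
exists (quot H); split; last exact: lagrangian_splittingP.
by rewrite dimvf.
Qed.

End Conditions.
End TableForm.

(** * The Lagrangian extensions of the classification *)

Definition pair_form (R : realType) (i j k l : nat) (lam mu : R) : nat -> nat -> R :=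
  fun a b => if (a == i) && (b == j) then lam
             else if (a == k) && (b == l) then mu else 0.

Definition diag_form (R : realType) : nat -> nat -> R :=
  fun a b => match a, b with
  | 1, 2 => 1
  | 3, 3 => 1
  | 4, 4 => 1
  | _, _ => 0
  end.

Definition ix1 : 'I_4 := @Ordinal 4 0 isT.
Definition ix2 : 'I_4 := @Ordinal 4 1 isT.
Definition ix3 : 'I_4 := @Ordinal 4 2 isT.
Definition ix4 : 'I_4 := @Ordinal 4 3 isT.

Lemma forall_I4 (P : 'I_4 -> Prop) :
  P ix1 -> P ix2 -> P ix3 -> P ix4 -> forall i, P i.
Proof.
move=> P1 P2 P3 P4; case=> [[|[|[|[|//]]]] k].
- by rewrite (_ : Ordinal k = ix1) //; apply: val_inj.
- by rewrite (_ : Ordinal k = ix2) //; apply: val_inj.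
- by rewrite (_ : Ordinal k = ix3) //; apply: val_inj.
- by rewrite (_ : Ordinal k = ix4) //; apply: val_inj.
Qed.

Ltac table_unfold :=
  rewrite /sum4 /sconst /fconst /pair_form /diag_form /=.
Ltac prove_parity := do 2 apply: forall_I4 => //.
Ltac prove_alternating := apply: forall_I4 => //.
Ltac prove_closed :=
  do 3 apply: forall_I4; move=> // _ _ _; table_unfold; lra.
Ltac prove_nondegenerate :=
  move=> x h;
  have := h ix1; have := h ix2; have := h ix3; have := h ix4;
  table_unfold => ? ? ? ?; apply: forall_I4 => /=; lra.
Ltac prove_ideal := do 3 apply: forall_I4; move=> // _ _; table_unfold; rewrite ?oppr0 //.
Ltac prove_polarized := do 2 apply: forall_I4; move=> // _; table_unfold; rewrite ?oppr0 //.

Ltac prove_lagrangian eps f i j :=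
  apply: (@table_lagrangian _ _ _ _ _ f eps i j);
  [ by [] | prove_parity | prove_alternating | prove_closed
  | prove_nondegenerate | prove_ideal | prove_polarized ].

Section Lists.
Variable R : realType.
Implicit Types p q : R.

(** The ideal is spanned by e2 and e3. The ratio of w(e3, e4) to w(e1, e2) is the
    one required by closedness on e1, e3, e4, on e2, e4, e4 or on e1, e4, e4; for
    D^7_{-q,q} these conditions leave it free. *)
Lemma Tstar_D7 q : Tstar_dim2 (D7 (- q) q).
Proof. prove_lagrangian false (pair_form 1 2 3 4 (1 : R) 1) ix1 ix4. Qed.

Lemma Tstar_D7_1mp_p p : Tstar_dim2 (D7_1mp_p p).
Proof. prove_lagrangian false (pair_form 1 2 3 4 (1 : R) 1) ix1 ix4. Qed.

Lemma Tstar_D10_0_1 : Tstar_dim2 (D10_0_1 R).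
Proof. prove_lagrangian false (pair_form 1 2 3 4 (1 : R) (- (1 / 2))) ix1 ix4. Qed.

Lemma Tstar_D10_0_2 : Tstar_dim2 (D10_0_2 R).
Proof. prove_lagrangian false (pair_form 1 2 3 4 (1 : R) (1 / 2)) ix1 ix4. Qed.

Lemma Tstar_C1_1_A : Tstar_dim2 (C1_1_A R).
Proof. prove_lagrangian false (pair_form 1 2 3 4 (1 : R) 1) ix1 ix4. Qed.

Lemma Tstar_C3_A : Tstar_dim2 (C3_A R).
Proof. prove_lagrangian false (pair_form 1 2 3 4 (1 : R) (1 / 2)) ix1 ix4. Qed.

(** In most cases the even part is a complement of the ideal, spanned by e3 and
    e4. The form has to be closed on e1, e2 and an odd vector, whence two
    different pairings: e1-e3, e2-e4 and e1-e4, e2-e3. *)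
Lemma PiTstar_D5 : PiTstar_dim2 (D5 R).
Proof. prove_lagrangian true (pair_form 1 3 2 4 (1 : R) 1) ix1 ix2. Qed.

Lemma PiTstar_D6 : PiTstar_dim2 (D6 R).
Proof. prove_lagrangian true (pair_form 1 3 2 4 (1 : R) 1) ix1 ix2. Qed.

Lemma PiTstar_D7 q : PiTstar_dim2 (D7 (- 1) q).
Proof. prove_lagrangian true (pair_form 1 4 2 3 (1 : R) 1) ix1 ix2. Qed.

Lemma PiTstar_D7_1_m1 : PiTstar_dim2 (D7 (1 : R) (- 1)).
Proof. prove_lagrangian true (pair_form 1 3 2 4 (1 : R) 1) ix1 ix2. Qed.

Lemma PiTstar_D8_m1 : PiTstar_dim2 (D8_m1 R).
Proof. prove_lagrangian true (pair_form 1 3 2 4 (1 : R) 1) ix1 ix2. Qed.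

(** Closedness on e1, e2, e4 forces w(e1, e3) = (q + 1) w(e2, e4), which is
    where q = -1 is lost. *)
Lemma PiTstar_D10 q : q != - 1 -> PiTstar_dim2 (D10 q).
Proof.
rewrite -subr_eq0 opprK => /mulIf q1.
have cancel_q y : y * (q + 1) = 0 -> y = 0.
  by rewrite -{1}(mul0r (q + 1)); exact: q1.
apply: (@table_lagrangian _ _ _ _ _ (pair_form 1 3 2 4 (q + 1) 1) true ix1 ix2).
- by [].
- prove_parity.
- prove_alternating.
- prove_closed.
- move=> x h; have := h ix1; have := h ix2; have := h ix3; have := h ix4.
  table_unfold => e4 e3 e2 e1.
  apply: forall_I4 => /=; try lra; apply: cancel_q; lra.
- prove_ideal.
- prove_polarized.
Qed.

(** Here [e4, e4] <> 0, so that the odd part is no abelian ideal; the ideal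
    spanned by e2 and e3 is isotropic for the odd form as well. *)
Lemma PiTstar_D10_0_1 : PiTstar_dim2 (D10_0_1 R).
Proof. prove_lagrangian true (pair_form 1 3 2 4 (1 : R) 1) ix1 ix4. Qed.

Lemma PiTstar_D10_0_2 : PiTstar_dim2 (D10_0_2 R).
Proof. prove_lagrangian true (pair_form 1 3 2 4 (1 : R) 1) ix1 ix4. Qed.

(** The ideal is the even part, which is central. Closedness on e3, e3, e4 and on
    e3, e4, e4 explains the sign. *)
Lemma PiTstar_A11_2A_3 : PiTstar_dim2 (A11_2A_3 (1 / 2 : R)).
Proof. prove_lagrangian true (pair_form 1 4 2 3 (-1 : R) 1) ix3 ix4. Qed.

Lemma big_I4 (V : nmodType) (F : 'I_4 -> V) :
  \sum_(i < 4) F i = F ix1 + F ix2 + F ix3 + F ix4.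
Proof.
rewrite !big_ord_recl big_ord0 addr0 !addrA.
by do ![congr (_ + _)]; congr F; apply: val_inj.
Qed.

Definition to_null_basis (x : r22 R) : r22 R :=
  \row_k nth 0 [:: x 0 ix1; x 0 ix2; x 0 ix3 + x 0 ix4;
                   (x 0 ix3 - x 0 ix4) / 2] k.

Definition of_null_basis (x : r22 R) : r22 R :=
  \row_k nth 0 [:: x 0 ix1; x 0 ix2; x 0 ix3 / 2 + x 0 ix4;
                   x 0 ix3 / 2 - x 0 ix4] k.

Lemma to_null_basis_linear : linear to_null_basis.
Proof.
by move=> k x y; apply/rowP; apply: forall_I4; rewrite !mxE /= ?mxE; field.
Qed.
HB.instance Definition _ := GRing.isLinear.Build R (r22 R) (r22 R) *:%R
  to_null_basis to_null_basis_linear.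

(** The odd vectors e3 and e4 are sent to e3 + e4 / 2 and e3 - e4 / 2, whose
    squares are e2 and - e2 and whose bracket is 0 when [e3, e4] = e2. *)
Lemma D7_half_2_iso : isomorphic (D7_half_2 R) (D7_1mp_p (1 / 2 : R)).
Proof.
exists (linfun to_null_basis); split.
- exists of_null_basis => x; rewrite lfunE; apply/rowP; apply: forall_I4;
    rewrite /to_null_basis /of_null_basis !mxE /= ?mxE /=; by field.
- move=> b x hx; rewrite lfunE; have x0 i := homog_coord0 (i := i) hx.
  apply/rowP; apply: forall_I4; rewrite !mxE; case: b hx x0 => hx x0 //=;
    by rewrite ?(x0 ix1 isT) ?(x0 ix2 isT) ?(x0 ix3 isT) ?(x0 ix4 isT)
      ?subr0 ?addr0 ?mul0r.
- move=> x y; rewrite !lfunE; apply/rowP; apply: forall_I4;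
    rewrite !mxE /= !table_br_coord !big_I4 /sconst !mxE /=; by field.
Qed.

End Lists.

Section Transport.
Variable R : realType.

Lemma isomorphic_trans (g1 g2 g3 : lieSuperalg R) :
  isomorphic g1 g2 -> isomorphic g2 g3 -> isomorphic g1 g3.
Proof.
move=> [f [fb fe fm]] [k [kb ke km]]; exists (k \o f)%VF; split.
- apply: (eq_bij (bij_comp kb fb)) => x; exact/esym/comp_lfunE.
- by move=> b x hx; rewrite comp_lfunE; exact/ke/fe.
- by move=> x y; rewrite !comp_lfunE fm km.
Qed.

Lemma Tstar_D7_half_2 : Tstar_dim2 (D7_half_2 R).
Proof.
have [h [dh [D [a [ca iso]]]]] := Tstar_D7_1mp_p (1 / 2 : R).
exists h; split=> //; exists D, a; split=> //.
exact: isomorphic_trans (@D7_half_2_iso R) iso.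
Qed.

End Transport.

(** * The exceptional algebras *)

Lemma odd_closed_square (R : realType) (g : lieSuperalg R)
    (w : 'Hom(g, 'Hom(g, R^o))) (x y : g) :
  closed_form w -> homog true x -> homog true y -> br x y = 0 ->
  w y (br x x) = 0.
Proof.
move=> cw hx hy xy; have := cw _ _ _ _ _ _ hx hx hy.
rewrite (br_anti hy hx) xy !(scaler0, oppr0) (linear0 (w x)) !mulr0 add0r addr0.
by rewrite expr1 mulN1r => /eqP; rewrite oppr_eq0 => /eqP.
Qed.

Lemma odd_closed_cube (R : realType) (g : lieSuperalg R)
    (w : 'Hom(g, 'Hom(g, R^o))) (x : g) :
  closed_form w -> homog true x -> w x (br x x) = 0.
Proof.
by move=> cw hx; have := cw _ _ _ _ _ _ hx hx hx; rewrite /= expr1 => e; lra.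
Qed.

Section Exceptional.
Variables (R : realType) (c : nat -> nat -> nat -> R).
Variables (ec : table_even c) (dc : table_diag c) (jc : table_jacobi c).
Let g := table_alg ec dc jc.
Local Notation e := (delta_mx 0 : 'I_4 -> g).

Let r22_sum (x : g) : x = (x : r22 R) 0 ix1 *: e ix1 + (x : r22 R) 0 ix2 *: e ix2 +
  (x : r22 R) 0 ix3 *: e ix3 + (x : r22 R) 0 ix4 *: e ix4.
Proof. by rewrite {1}(row_sum_delta (x : r22 R)) big_I4. Qed.

Let e_neq0 i : e i != 0.
Proof.
apply/eqP => /(congr1 (fun x : r22 R => x 0 i)); rewrite !mxE !eqxx => /eqP.
by rewrite oner_eq0.
Qed.

Lemma table_orthosymplectic f :
  table_parity f false -> table_alternating f -> table_closed c f false ->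
  table_nondegenerate f -> orthosymplectic_quasi_frobenius g.
Proof.
move=> pf af cf nf; exists (table_form f); split.
- exact: table_form_anti.
- exact: (table_form_closed pf cf).
- exact: table_form_nondegenerate.
- move=> a b x y hx hy ab; apply: (table_form_parity pf hx hy).
  by case: a ab {hx}; case: b {hy}.
Qed.

Hypothesis br33 : br (e ix3) (e ix3) = e ix2.
Hypothesis br34 : br (e ix3) (e ix4) = 0.

(** Closedness of an odd form on three odd vectors makes [e3, e3] orthogonal to
    the odd part, and parity makes it orthogonal to the even part. *)
Lemma not_PiTstar : ~ (exists h, is_PiTstar_extension g h).
Proof.
move=> [h /(@lagrangian_extension_form R true)[w [[aw cw nw pw] _]]].
have h3 : homog true (e ix3) := homog_e R ix3.
have h4 : homog true (e ix4) := homog_e R ix4.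
have h2 : homog false (e ix2) := homog_e R ix2.
have h1 : homog false (e ix1) := homog_e R ix1.
have w32 : w (e ix3) (e ix2) = 0 by rewrite -br33; exact: odd_closed_cube.
have w42 : w (e ix4) (e ix2) = 0 by rewrite -br33; exact: odd_closed_square.
case/eqP: (e_neq0 ix2); apply: nw => y; rewrite (r22_sum y) !form_Dr !form_Zr.
rewrite (pw _ _ _ _ h2 h1) // (pw _ _ _ _ h2 h2) // (aw _ _ _ _ h2 h3).
by rewrite (aw _ _ _ _ h2 h4) w32 w42 !mulr0 !oppr0 !mulr0 !addr0.
Qed.

Lemma Tstar_odd_null : (exists h, is_Tstar_extension g h) ->
  exists w : 'Hom(g, 'Hom(g, R^o)),
    [/\ antisymmetric_form w, closed_form w, nondegenerate_form w &
        parity_form false w] /\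
    exists x : g, [/\ homog true x, x != 0, br x x = 0 & w x x = 0].
Proof.
move=> [h /(@lagrangian_extension_form R false)[w [Hw odd_null]]].
exists w; split=> //; apply: (odd_null (e ix3)) => //.
exact: (homog_e R ix3).
Qed.

Let sq_coord2 (x : g) : homog true x -> br x x = 0 ->
  (x : r22 R) 0 ix3 ^+ 2 + (x : r22 R) 0 ix4 ^+ 2 *
    sconst c 4 4 2 = 0.
Proof.
move=> hx; have x1 := homog_coord0 (i := ix1) hx isT.
have x2 := homog_coord0 (i := ix2) hx isT.
have coord (i j : 'I_4) : sconst c i.+1 j.+1 2 = (br (e i) (e j) : r22 R) 0 ix2.
  by rewrite /= table_br_e.
have s33 : sconst c 3 3 2 = 1.
  by rewrite (coord ix3 ix3) br33 mxE.
have s34 : sconst c 3 4 2 = 0 by rewrite (coord ix3 ix4) br34 mxE.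
have s43 : sconst c 4 3 2 = 0 by move: s34; rewrite /sconst /=.
move=> /(congr1 (fun y : r22 R => y 0 ix2)).
rewrite /= table_br_coord !big_I4 x1 x2 mxE /= s33 s34 s43 => xx.
by rewrite -[RHS]xx; ring.
Qed.

Lemma not_Tstar_definite : sconst c 4 4 2 = 1 ->
  ~ (exists h, is_Tstar_extension g h).
Proof.
move=> s44 /Tstar_odd_null[w [_ [x [hx nx xx _]]]].
have := sq_coord2 hx xx; rewrite s44 mulr1 => /eqP.
rewrite paddr_eq0 ?sqr_ge0 // !sqrf_eq0 => /andP[/eqP x3 /eqP x4].
case/eqP: nx; rewrite (r22_sum x) x3 x4.
rewrite (homog_coord0 (i := ix1) hx isT) (homog_coord0 (i := ix2) hx isT).
by rewrite !scale0r !addr0.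
Qed.

(** An odd null vector is a multiple of e4, and e4 is orthogonal to e3 because
    e3 is an eigenvector of e1 for a nonzero eigenvalue while e4 commutes with
    e1 and e3. *)
Lemma not_Tstar_degenerate : sconst c 4 4 2 = 0 ->
  br (e ix1) (e ix4) = 0 -> br (e ix1) (e ix3) = (1 / 2) *: e ix3 ->
  ~ (exists h, is_Tstar_extension g h).
Proof.
move=> s44 br14 br13 /Tstar_odd_null[w [[aw cw nw pw] [x [hx nx xx wxx]]]].
have h1 : homog false (e ix1) := homog_e R ix1.
have h2 : homog false (e ix2) := homog_e R ix2.
have h3 : homog true (e ix3) := homog_e R ix3.
have h4 : homog true (e ix4) := homog_e R ix4.
have := sq_coord2 hx xx; rewrite s44 mulr0 addr0 => /eqP.
rewrite sqrf_eq0 => /eqP x3.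
have xE : x = (x : r22 R) 0 ix4 *: e ix4.
  rewrite {1}(r22_sum x) x3 (homog_coord0 (i := ix1) hx isT).
  by rewrite (homog_coord0 (i := ix2) hx isT) !scale0r !add0r.
have x4 : (x : r22 R) 0 ix4 != 0.
  by apply: contraNneq nx => x4; rewrite xE x4 scale0r.
have w44 : w (e ix4) (e ix4) = 0.
  move: wxx; rewrite xE form_Zl form_Zr => /eqP.
  by rewrite !mulf_eq0 (negbTE x4) => /eqP.
have w43 : w (e ix4) (e ix3) = 0.
  have := cw _ _ _ _ _ _ h1 h3 h4.
  rewrite br34 br13 (br_anti h4 h1) br14 !(scaler0, oppr0, form_Zr).
  rewrite (linear0 (w _)) (linear0 (w _)) /= expr1 expr0 => e0; lra.
case/eqP: (e_neq0 ix4); apply: nw => y; rewrite (r22_sum y) !form_Dr !form_Zr.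
rewrite (pw _ _ _ _ h4 h1) // (pw _ _ _ _ h4 h2) // w43 w44.
by rewrite !mulr0 !addr0.
Qed.

End Exceptional.

Ltac prove_bracket :=
  apply/rowP; apply: forall_I4; rewrite /= ?table_br_e ?mxE /= ?mxE ?table_br_e
    /sconst /= ?mulr0 ?mulr1.
Ltac prove_orthosymplectic :=
  apply: (@table_orthosymplectic _ _ _ _ _ (diag_form _));
  [ prove_parity | prove_alternating | prove_closed | prove_nondegenerate ].

Definition exceptional (R : realType) (g : lieSuperalg R) : Prop :=
  [/\ orthosymplectic_quasi_frobenius g,
      ~ (exists h : lieSuperalg R, is_Tstar_extension g h)
    & ~ (exists h : lieSuperalg R, is_PiTstar_extension g h)].

Lemma exceptional_D7_half_1 (R : realType) : exceptional (D7_half_1 R).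
Proof.
split; first by prove_orthosymplectic.
- by apply: not_Tstar_definite; [prove_bracket|prove_bracket|].
- by apply: not_PiTstar; prove_bracket.
Qed.

Lemma exceptional_D9_half (R : realType) (p : R) : exceptional (D9_half p).
Proof.
split; first by prove_orthosymplectic.
- by apply: not_Tstar_definite; [prove_bracket|prove_bracket|].
- by apply: not_PiTstar; prove_bracket.
Qed.

Lemma exceptional_C1_half_A (R : realType) : exceptional (C1_half_A R).
Proof.
split; first by prove_orthosymplectic.
- by apply: not_Tstar_degenerate; [prove_bracket|prove_bracket| |prove_bracket|prove_bracket].
- by apply: not_PiTstar; prove_bracket.
Qed.

Theorem mainTheorem2 (R : realType) :
  ((forall q : R, q != 0 -> Tstar_dim2 (D7 (- q) q))
   /\ Tstar_dim2 (D7_half_2 R)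
   /\ (forall p : R, p <= 1 / 2 -> Tstar_dim2 (D7_1mp_p p))
   /\ Tstar_dim2 (D10_0_1 R)
   /\ Tstar_dim2 (D10_0_2 R)
   /\ Tstar_dim2 (C1_1_A R)
   /\ Tstar_dim2 (C3_A R))
  /\
  (PiTstar_dim2 (D5 R)
   /\ PiTstar_dim2 (D6 R)
   /\ (forall q : R, q <= 1 -> q != 0 -> PiTstar_dim2 (D7 (- 1) q))
   /\ PiTstar_dim2 (D7 (1 : R) (- 1))
   /\ PiTstar_dim2 (D8_m1 R)
   /\ (forall q : R, q != - 1 -> PiTstar_dim2 (D10 q))
   /\ PiTstar_dim2 (D10_0_1 R)
   /\ PiTstar_dim2 (D10_0_2 R)
   /\ PiTstar_dim2 (A11_2A_3 (1 / 2 : R)))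
  /\
  (let exceptional (g : lieSuperalg R) :=
     [/\ orthosymplectic_quasi_frobenius g,
         ~ (exists h : lieSuperalg R, is_Tstar_extension g h)
       & ~ (exists h : lieSuperalg R, is_PiTstar_extension g h)] in
   exceptional (D7_half_1 R)
   /\ (forall p : R, 0 < p -> exceptional (D9_half p))
   /\ exceptional (C1_half_A R)).
Proof.
split; [|split].
- split=> [q _|]; first exact: Tstar_D7.
  split; first exact: Tstar_D7_half_2.
  split=> [p _|]; first exact: Tstar_D7_1mp_p.
  split; first exact: Tstar_D10_0_1.
  split; first exact: Tstar_D10_0_2.
  by split; [exact: Tstar_C1_1_A|exact: Tstar_C3_A].
- split; first exact: PiTstar_D5.
  split; first exact: PiTstar_D6.
  split=> [q _ _|]; first exact: PiTstar_D7.
  split; first exact: PiTstar_D7_1_m1.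
  split; first exact: PiTstar_D8_m1.
  split; first exact: PiTstar_D10.
  split; first exact: PiTstar_D10_0_1.
  by split; [exact: PiTstar_D10_0_2|exact: PiTstar_A11_2A_3].
- split; first exact: exceptional_D7_half_1.
  by split=> [p _|]; [exact: exceptional_D9_half|exact: exceptional_C1_half_A].
Qed.
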